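(* For every real number $t>\dfrac{\sqrt{15-\sqrt{33}}}{2\sqrt{2}}$, the union $P_0^t\cup P_1^t\cup P_2^t$ is locally polynomially convex at the origin, where $P_0^t,P_1^t,P_2^t\subset\mathbb{C}^2$ are the real planes $$P_0^t=\{(z,w)\in\mathbb{C}^2: w=\overline{z}\},$$ $$P_1^t=\Big\{(z,w)\in\mathbb{C}^2: w=-\tfrac{\sqrt{3}(\sqrt{3}-i)}{2t}\,z-\tfrac{1-i\sqrt{3}}{2}\,\overline{z}\Big\},$$ $$P_2^t=\Big\{(z,w)\in\mathbb{C}^2: w=-\tfrac{\sqrt{3}(\sqrt{3}+i)}{2t}\,z-\tfrac{1+i\sqrt{3}}{2}\,\overline{z}\Big\}.$$
   Context: For a compact set $K\subset\mathbb{C}^n$, the polynomially convex hull is $\widehat{K}=\{z\in\mathbb{C}^n: |p(z)|\le\sup_K|p| \text{ for all } p\in\mathbb{C}[z_1,\dots,z_n]\}$; $K$ is polynomially convex if $\widehat{K}=K$. A closed set $E\subset\mathbb{C}^n$ is locally polynomially convex at $p\in E$ if $E\cap\overline{B(p;r)}$ is polynomially convex for some $r>0$, where $B(p;r)$ is the open ball in $\mathbb{C}^n$ with centre $p$ and radius $r$. *)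

(* Defs.v *)
From HB Require Import structures.
From mathcomp Require Import all_boot all_order all_algebra.
From mathcomp Require Import all_classical all_reals all_analysis.
From mathcomp Require Import complex.
(* mpoly is not imported: its notations clash with those of mathcomp-analysis. *)
From mathcomp Require mpoly.

Set Implicit Arguments.
Unset Strict Implicit.
Unset Printing Implicit Defensive.

Import Order.TTheory GRing.Theory Num.Theory numFieldNormedType.Exports.

Local Open Scope classical_set_scope.
Local Open Scope ring_scope.

(* The alias ^o equips the complex numbers with the topology of the modulus;
   row vectors then carry the product topology. *)
Notation Cvec R n := 'rV[(complex R)^o]_n.

(* The library norm on row vectors is the maximum norm, whose balls are
   polydiscs; the Euclidean norm has to be defined separately. *)
Definition enorm (R : realType) (n : nat) (z : Cvec R n) : R :=
  Num.sqrt (\sum_(i < n) Normc.normc (z 0 i) ^+ 2).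

Definition eball (R : realType) (n : nat) (p : Cvec R n) (r : R) :
    set (Cvec R n) :=
  [set z : Cvec R n | enorm (z - p) < r].

Definition absp (R : realType) (n : nat) (p : mpoly.mpoly n (complex R))
    (z : Cvec R n) : R :=
  Normc.normc (mpoly.meval (z 0) p).

(* The supremum is taken in the extended reals since the real-valued sup
   returns 0 on empty and unbounded sets. *)
Definition poly_hull (R : realType) (n : nat) (K : set (Cvec R n)) :
    set (Cvec R n) :=
  [set z : Cvec R n | forall p : mpoly.mpoly n (complex R),
     ((absp p z)%:E <= ereal_sup [set (absp p x)%:E | x in K])%E].

Definition poly_convex (R : realType) (n : nat) (K : set (Cvec R n)) : Prop :=
  poly_hull K = K.

(* As E is closed, the set required to be polynomially convex is compact. *)
Definition locally_poly_convex (R : realType) (n : nat)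
    (E : set (Cvec R n)) (p : Cvec R n) : Prop :=
  [/\ closed E, E p &
      exists2 r : R, 0 < r & poly_convex (E `&` closure (eball p r))].

Local Open Scope complex_scope.

Definition P0 (R : realType) : set (Cvec R 2) :=
  [set v : Cvec R 2 |
     let z : R[i] := v 0 0 in let w : R[i] := v 0 1 in w = z^*%C].

Definition P1 (R : realType) (t : R) : set (Cvec R 2) :=
  [set v : Cvec R 2 |
     let z : R[i] := v 0 0 in let w : R[i] := v 0 1 in
     let s : R[i] := (Num.sqrt 3)%:C in
     w = - (s * (s - 'i%C) / (2 * t%:C)) * z - (1 - 'i%C * s) / 2 * z^*%C].

Definition P2 (R : realType) (t : R) : set (Cvec R 2) :=
  [set v : Cvec R 2 |
     let z : R[i] := v 0 0 in let w : R[i] := v 0 1 in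
     let s : R[i] := (Num.sqrt 3)%:C in
     w = - (s * (s + 'i%C) / (2 * t%:C)) * z - (1 + 'i%C * s) / 2 * z^*%C].

(* Main.v *)
Require Import Defs.
From mathcomp Require Import all_boot all_order all_algebra.
From mathcomp Require Import all_classical all_reals all_analysis.
From mathcomp Require Import complex ring lra.
From mathcomp Require mpoly.

(** Put [c = 1/t] and [w' = w + c z]: the planes become
    [w' = omega^j (conj z + c z)] with [omega = e^(2 i pi/3)].  Kallin's lemma is
    applied twice.  First, a quadratic form [F] in [z, w'] maps the plane [j = 0]
    into the open wedge [|arg| < phi] and the planes [j = 1, 2] outside the closed
    one; for [c^2 < 3/4] one takes [F = z w'] and [phi = pi/3], otherwise
    [phi = pi/6] and a perturbation of [z w' + (c - 1/c) z^2 + w'^2 / c], which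
    works exactly when [12 c^4 - 15 c^2 + 4 < 0]; this is where the bound on [t]
    comes from.  Then [Im (z w' + (c/2) z^2)] is positive on the plane [j = 1]
    and negative on the plane [j = 2].  Finally, a ball of a single plane is
    polynomially convex because the coordinates [Re z] and [Im z] are restrictions
    of polynomials which are real on the plane.

    Kallin's lemma is proved without measures: for [x] in the hull of [K], the
    uniform closure of the polynomials on [K] and [x] contains the inverses, square
    roots and sign-function iterates of its elements whenever these are defined
    along a ray to infinity, and the value at [x] stays dominated by the supremum
    over [K]. *)

Set Implicit Arguments.
Unset Strict Implicit.
Unset Printing Implicit Defensive.

Import Order.TTheory GRing.Theory Num.Theory numFieldNormedType.Exports.
Import (canonicals, coercions) mpoly.

Local Open Scope classical_set_scope.
Local Open Scope ring_scope.
Local Open Scope complex_scope.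

Local Notation normc := Normc.normc.
Local Notation Re := complex.Re.
Local Notation Im := complex.Im.

(** * Moduli, real parts and imaginary parts of complex numbers *)

Section ComplexModulus.
Variable R : realType.
Implicit Types (x y z : R[i]) (a b : R).

Lemma normc_ge0 z : 0 <= normc z.
Proof. by case: z => a b; exact: sqrtr_ge0. Qed.

Lemma normc_sqr z : normc z ^+ 2 = Re z ^+ 2 + Im z ^+ 2.
Proof. by case: z => a b /=; rewrite sqr_sqrtr // addr_ge0 // sqr_ge0. Qed.

Lemma normc_real a : normc a%:C = `|a|.
Proof. by rewrite /= expr0n addr0 sqrtr_sqr. Qed.

Lemma normcX z n : normc (z ^+ n) = normc z ^+ n.
Proof. by elim: n => [|n IH]; rewrite ?expr0 ?Normc.normc1 // !exprS Normc.normcM IH. Qed.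

Lemma normc_gt0 z : (0 < normc z) = (z != 0).
Proof.
rewrite lt_def normc_ge0 andbT; apply/idP/idP; apply: contra => /eqP.
  by move=> ->; rewrite Normc.normc0.
by move/Normc.eq0_normc => ->.
Qed.

Lemma normcB_ge x y : normc x - normc y <= normc (x - y).
Proof. by rewrite lerBlDr -{1}(subrK y x) le_normcD. Qed.

Lemma normcD_ge x y : normc x - normc y <= normc (x + y).
Proof. by rewrite -{2}[y]opprK -(normcN y) normcB_ge. Qed.

Lemma Re_le_normc z : `|Re z| <= normc z.
Proof.
rewrite -(ler_pXn2r (n:=2)) ?nnegrE ?normc_ge0 // normc_sqr real_normK ?num_real //.
by rewrite lerDl sqr_ge0.
Qed.

Lemma Im_le_normc z : `|Im z| <= normc z.
Proof.
rewrite -(ler_pXn2r (n:=2)) ?nnegrE ?normc_ge0 // normc_sqr real_normK ?num_real //.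
by rewrite lerDr sqr_ge0.
Qed.

Lemma cReD x y : Re (x + y) = Re x + Re y. Proof. by case: x y => [? ?] [? ?]. Qed.
Lemma cImD x y : Im (x + y) = Im x + Im y. Proof. by case: x y => [? ?] [? ?]. Qed.
Lemma cReN x : Re (- x) = - Re x. Proof. by case: x. Qed.
Lemma cImN x : Im (- x) = - Im x. Proof. by case: x. Qed.
Lemma cReM x y : Re (x * y) = Re x * Re y - Im x * Im y.
Proof. by case: x y => [? ?] [? ?]. Qed.

End ComplexModulus.

(** * Powers of real numbers *)

Section RealPowers.
Variable R : realType.
Implicit Types (a c e q s : R).

Lemma expr_small q e : 0 <= q -> q < 1 -> 0 < e -> exists n, q ^+ n <= e.
Proof.
move=> q0 q1 e0; have /cvgrPdist_le/(_ e e0) : (fun n => q ^+ n) @ \oo --> (0 : R).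
  by apply: cvg_expr; rewrite ger0_norm.
move=> [N _ /(_ N (leqnn N))]; rewrite sub0r normrN ger0_norm ?exprn_ge0 // => h.
by exists N.
Qed.

Lemma expr2n_le q n : 0 <= q -> q <= 1 -> q ^+ (2 ^ n) <= q ^+ n.
Proof. by move=> q0 q1; apply: ler_wiXn2l => //; exact/ltnW/ltn_expl. Qed.

(** If [s < a], then [c <= M * (s / a) ^+ n] for all [n], and the right side tends to 0. This
    removes the constants [c] and [M] when high powers of a function are compared. *)
Lemma le_of_expr_le a s c M : 0 <= a -> 0 <= s -> 0 < c ->
  (forall n, a ^+ n * c <= M * s ^+ n) -> a <= s.
Proof.
move=> a0 s0 c0 h; rewrite leNgt; apply/negP => sa.
have ap : 0 < a by exact: le_lt_trans sa.
have M0 : 0 < M.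
  by have := h 0%N; rewrite !expr0 mul1r mulr1; exact: lt_le_trans.
have [n hn] : exists n, (s / a) ^+ n <= c / (M *+ 2).
  apply: expr_small; first by rewrite divr_ge0.
    by rewrite ltr_pdivrMr // mul1r.
  by rewrite divr_gt0 // pmulrn_lgt0.
have : c <= M * (s / a) ^+ n.
  by rewrite expr_div_n mulrA ler_pdivlMr ?exprn_gt0 // mulrC.
have : M * (s / a) ^+ n <= M * (c / (M *+ 2)) by rewrite ler_pM2l.
have -> : M * (c / (M *+ 2)) = c / 2.
  by field; rewrite gt_eqF.
lra.
Qed.

End RealPowers.

(** * Uniform algebras on a set and a point of its hull *)

(** The model is the uniform closure of the polynomials on [K] and [x], evaluation at [x] being a
    character dominated by the norm over [K]. Bounds are stated for every majorant [M], which avoids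
    suprema. *)
Record hull_algebra (R : realType) (T : Type) (A : set (T -> R[i]))
    (K : set T) (x : T) : Prop := HullAlgebra {
  hull_const : forall c, A (fun=> c);
  hull_add : forall f g, A f -> A g -> A (fun y => f y + g y);
  hull_mul : forall f g, A f -> A g -> A (fun y => f y * g y);
  hull_bounded : forall f, A f -> exists M, forall y, K y -> normc (f y) <= M;
  hull_closed : forall f,
    (forall e, 0 < e -> exists2 g, A g &
       forall y, K y \/ y = x -> normc (f y - g y) <= e) -> A f;
  hull_bound : forall f M, A f -> (forall y, K y -> normc (f y) <= M) ->
    normc (f x) <= M }.

Section HullAlgebra.
Variables (R : realType) (T : Type) (A : set (T -> R[i])) (K : set T) (x : T).
Hypothesis HA : hull_algebra A K x.
Implicit Types (f g u : T -> R[i]) (y : T) (s d q k : R).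
Local Notation Y := (fun y => K y \/ y = x).

(** By [hull_closed] only the values on [K] and at [x] matter, so the default values of inverses
    elsewhere are harmless. *)
Lemma hull_ext f g : A f -> (forall y, Y y -> g y = f y) -> A g.
Proof.
move=> Af fg; apply: (hull_closed HA) => e e0; exists f => // y Yy.
by rewrite fg // subrr Normc.normc0 ltW.
Qed.

Lemma hull_scale c f : A f -> A (fun y => c * f y).
Proof. by move=> Af; exact: (hull_mul HA (hull_const HA c) Af). Qed.

Lemma hull_sub f g : A f -> A g -> A (fun y => f y - g y).
Proof.
move=> Af Ag; apply: (hull_ext (hull_add HA Af (hull_scale (-1) Ag))) => y _.
by rewrite mulN1r.
Qed.

Lemma hull_exp f n : A f -> A (fun y => f y ^+ n).
Proof.
move=> Af; elim: n => [|n IH].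
  by apply: (hull_ext (hull_const HA 1)) => y _; rewrite expr0.
by apply: (hull_ext (hull_mul HA Af IH)) => y _; rewrite exprS.
Qed.

Lemma hull_boundY f M : A f -> (forall y, K y -> normc (f y) <= M) ->
  forall y, Y y -> normc (f y) <= M.
Proof. by move=> Af h y [/h //|->]; exact: (hull_bound HA Af). Qed.

Lemma hull_boundedY f : A f -> exists2 M, 0 < M & forall y, Y y -> normc (f y) <= M.
Proof.
move=> Af; have [M h] := hull_bounded HA Af.
exists (`|M| + 1); first by rewrite ltr_wpDl.
move=> y Yy; apply: le_trans (_ : M <= _); first exact: hull_boundY Yy.
by apply: le_trans (ler_norm M) _; rewrite lerDl.
Qed.

Lemma hull_eqY f g : A f -> A g -> (forall y, K y -> f y = g y) ->
  forall y, Y y -> f y = g y.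
Proof.
move=> Af Ag h y Yy; apply/eqP; rewrite -subr_eq0; apply/eqP/Normc.eq0_normc.
apply/eqP; rewrite eq_le normc_ge0 andbT.
apply: (hull_boundY (hull_sub Af Ag)) Yy => z Kz.
by rewrite h // subrr Normc.normc0.
Qed.

(** The bound [q] also holds at [x], so the geometric series converges uniformly, with remainder at
    most [q ^+ n / (1 - q)]. *)
Lemma hull_geometric u q : A u -> 0 <= q -> q < 1 ->
  (forall y, K y -> normc (u y) <= q) -> A (fun y => (1 - u y)^-1).
Proof.
move=> Au q0 q1 /(hull_boundY Au) uq; apply: (hull_closed HA) => e e0.
have [n hn] : exists n, q ^+ n <= e * (1 - q).
  by apply: expr_small => //; rewrite mulr_gt0 // subr_gt0.
exists (fun y => \sum_(i < n) u y ^+ i).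
  elim: n {hn} => [|n IH].
    by apply: (hull_ext (hull_const HA 0)) => y _; rewrite big_ord0.
  apply: (hull_ext (hull_add HA IH (hull_exp n Au))) => y _.
  by rewrite big_ord_recr.
move=> y Yy.
have d0 : 0 < 1 - q by rewrite subr_gt0.
have dn : 1 - q <= normc (1 - u y).
  apply: le_trans (normcB_ge _ _); rewrite Normc.normc1 lerD2l lerN2; exact: uq.
have nz : 1 - u y != 0 by rewrite -normc_gt0; exact: lt_le_trans dn.
have -> : (1 - u y)^-1 - \sum_(i < n) u y ^+ i = u y ^+ n * (1 - u y)^-1.
  apply: (mulfI nz); rewrite mulrBr divff // mulrCA divff // mulr1.
  have -> : u y ^+ n = 1 + (u y ^+ n - 1) by ring.
  by rewrite subrX1; ring.
rewrite Normc.normcM Normc.normcV normcX ler_pdivrMr; last exact: lt_le_trans dn.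
apply: le_trans (_ : q ^+ n <= _).
  by rewrite lerXn2r ?nnegrE ?normc_ge0 // uq.
by apply: le_trans hn _; rewrite ler_pM2l.
Qed.

Lemma normcDr_ge z s : 0 <= s -> s - normc z <= normc (z + s%:C).
Proof.
move=> s0; have := normcD_ge s%:C z.
by rewrite normc_real ger0_norm // [s%:C + z]addrC.
Qed.

(* Runge's theorem with the pole pushed to infinity along the negative axis:
   [(f + s)^-1] is reached from large [s] by steps of length [d / 2]. *)
Lemma hull_inv_ray f d : A f -> 0 < d ->
  (forall y s, K y -> 0 <= s -> d <= normc (f y + s%:C)) ->
  forall s, 0 <= s -> A (fun y => (f y + s%:C)^-1) /\
    (forall y, Y y -> d <= normc (f y + s%:C)).
Proof.
move=> Af d0 fd.
(* An inverse of [f + s] over [K] remains one at [x], because identities carry over; its bound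
   [d^-1] carries over as well. *)
have inv_bound s g : 0 <= s -> A g ->
    (forall y, K y -> g y * (f y + s%:C) = 1) ->
    forall y, Y y -> g y = (f y + s%:C)^-1 /\ d <= normc (f y + s%:C).
  move=> s0 Ag gK y Yy.
  have e1 : g y * (f y + s%:C) = 1.
    exact: (hull_eqY (hull_mul HA Ag (hull_add HA Af (hull_const HA s%:C)))
                     (hull_const HA 1) gK Yy).
  have nz : f y + s%:C != 0.
    by apply/eqP => h; move: e1; rewrite h mulr0 => /eqP; rewrite eq_sym oner_eq0.
  have gE : g y = (f y + s%:C)^-1 by apply: (mulIf nz); rewrite e1 mulVf.
  split=> //; rewrite -[leLHS]invrK -[leRHS]invrK lef_pV2 ?posrE ?invr_gt0 ?normc_gt0 //.
  rewrite -Normc.normcV -gE.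
  apply: (hull_boundY Ag) Yy => z Kz.
  have nzz : f z + s%:C != 0 by rewrite -normc_gt0; exact: lt_le_trans (fd z s Kz s0).
  have -> : g z = (f z + s%:C)^-1 by apply: (mulIf nzz); rewrite gK // mulVf.
  by rewrite Normc.normcV lef_pV2 ?posrE ?normc_gt0 // fd.
have [M M0 fM] := hull_boundedY Af.
(* Here [n] counts the steps of length [d / 2] below [M *+ 2]; from that value on, [f / s] has
   modulus at most 1/2 and the geometric series applies directly. *)
suff main n s : 0 <= s -> M *+ 2 - n%:R * (d / 2) <= s -> A (fun y => (f y + s%:C)^-1).
  move=> s s0.
  have As : A (fun y => (f y + s%:C)^-1).
    pose n := Num.Def.archi_bound (M *+ 2 / (d / 2)).
    apply: (main n) => //; apply: le_trans s0; rewrite subr_le0.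
    rewrite -ler_pdivrMr ?divr_gt0 //; apply: ltW.
    apply: archi_boundP; rewrite divr_ge0 ?mulrn_wge0 ?ltW // divr_gt0 //.
  split=> // y Yy; apply: (inv_bound _ _ s0 As _ _ Yy).2 => z Kz.
  by rewrite mulVf // -normc_gt0; exact: lt_le_trans (fd z s Kz s0).
elim: n s => [|n IH] s s0 hs.
  have sp : 0 < s by apply: lt_le_trans hs; rewrite mul0r subr0 pmulrn_lgt0.
  have snz : s%:C != 0 by rewrite -normc_gt0 normc_real gtr0_norm.
  have Ag : A (fun y => (1 - (- s^-1)%:C * f y)^-1).
    apply: (@hull_geometric _ (1 / 2) (hull_scale _ Af)); [lra|lra|].
    move=> y Ky; rewrite Normc.normcM normc_real normrN gtr0_norm ?invr_gt0 //.
    rewrite ler_pdivrMl //; apply: le_trans (fM y (or_introl Ky)) _.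
    by move: hs; lra.
  apply: (hull_ext (hull_scale (s^-1)%:C Ag)) => y _.
  have sV : (s^-1)%:C = (s%:C)^-1 :> R[i] by exact: fmorphV.
  have -> : (- s^-1)%:C = - (s%:C)^-1 :> R[i] by rewrite -sV -rmorphN.
  rewrite sV -invfM; congr (_^-1).
  by rewrite mulNr opprK mulrDr mulr1 mulVKf // addrC.
have s'0 : 0 <= s + d / 2 by rewrite addr_ge0 // divr_ge0 // ltW.
have As' : A (fun y => (f y + (s + d / 2)%:C)^-1).
  by apply: IH => //; move: hs; rewrite -natr1 mulrDl; lra.
have gE y : Y y -> d <= normc (f y + (s + d / 2)%:C).
  move=> Yy; apply: (inv_bound _ _ s'0 As' _ _ Yy).2 => z Kz.
  by rewrite mulVf // -normc_gt0; exact: lt_le_trans (fd z _ Kz s'0).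
(* One step: with [g = f + s + d / 2], one has [f + s = g (1 - (d / 2) / g)], and the quotient has
   modulus at most 1/2. *)
have Ag : A (fun y => (1 - (d / 2)%:C * (f y + (s + d / 2)%:C)^-1)^-1).
  apply: (@hull_geometric _ (1 / 2) (hull_scale _ As')); [lra|lra|] => y Ky.
  have h := gE y (or_introl Ky).
  rewrite Normc.normcM normc_real Normc.normcV gtr0_norm ?divr_gt0 //.
  rewrite ler_pdivrMr; first by lra.
  exact: lt_le_trans h.
apply: (hull_ext (hull_mul HA As' Ag)) => y Yy.
have nz : f y + (s + d / 2)%:C != 0 by rewrite -normc_gt0; exact: lt_le_trans (gE y Yy).
rewrite -invfM mulrBr mulr1 mulrCA divff // mulr1; congr (_^-1).
by rewrite -addrA -rmorphB addrK.
Qed.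
End HullAlgebra.

(** For [0 < k <= 1] this is the complement of the open sector of half-angle [arcsin k] around the
    negative real axis. It is invariant under positive scaling and contains 0. *)
Definition slit (R : realType) (k : R) (z : R[i]) :=
  forall s, 0 <= s -> k * s <= normc (z + s%:C).

(** * Sectors around the negative axis, square roots and Cayley transforms *)

Section SlitPlane.
Variable R : realType.
Implicit Types (z r q : R[i]) (k s e d rho : R).

Lemma slit_shift k z e : 0 <= k -> slit k z -> 0 <= e -> slit k (z + e%:C).
Proof.
move=> k0 zk e0 s s0; rewrite -addrA -rmorphD; apply: le_trans (zk _ _).
  by rewrite ler_wpM2l // lerDr.
exact: addr_ge0.
Qed.

Lemma slit_ge k z e : 0 <= k -> slit k z -> 0 <= e ->
  k * (normc z + e) <= (k + 2) * normc (z + e%:C).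
Proof.
move=> k0 zk e0; have h1 := zk _ e0.
have h2 : normc z - e <= normc (z + e%:C).
  by have := normcD_ge z e%:C; rewrite normc_real ger0_norm.
have := ler_wpM2l k0 h2; lra.
Qed.

(** Add the hypothesis to [k] times the inequality [s - |z| <= |z + s|]. *)
Lemma slit_of_ray k z : 0 <= k ->
  (forall s, 0 <= s -> k * normc z <= normc (z + s%:C)) -> slit (k / (1 + k)) z.
Proof.
move=> k0 h s s0; rewrite mulrAC ler_pdivrMr; last lra.
have := h s s0; have := ler_wpM2l k0 (normcDr_ge z s0); lra.
Qed.

Lemma Re_sqrtc_ge0 z : 0 <= Re (sqrtc z).
Proof. by case: z => a b; exact: sqrtr_ge0. Qed.

(** Take [s = |r|^2] in the slit condition: [|r^2 + |r|^2| = |r| |r + conj r| = 2 |r| Re r]. *)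
Lemma slit_sqrt k r : 0 <= k -> slit k (r ^+ 2) -> 0 <= Re r ->
  k / 2 * normc r <= Re r.
Proof.
move=> k0 /(_ (normc r ^+ 2) (sqr_ge0 _)) h a0.
have [->|rnz] := eqVneq r 0; first by rewrite Normc.normc0 mulr0.
have n0 : 0 < normc r by rewrite normc_gt0.
have : (k * normc r ^+ 2) ^+ 2 <= normc (r ^+ 2 + (normc r ^+ 2)%:C) ^+ 2.
  by rewrite lerXn2r ?nnegrE ?mulr_ge0 ?normc_ge0.
have -> : normc (r ^+ 2 + (normc r ^+ 2)%:C) ^+ 2 = (2 * Re r) ^+ 2 * normc r ^+ 2.
  rewrite !normc_sqr; case: (r) => a b /=.
  by rewrite expr2 /=; ring.
have -> : (k * normc r ^+ 2) ^+ 2 = (k * normc r) ^+ 2 * normc r ^+ 2 by ring.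
rewrite ler_pM2r ?exprn_gt0 // ler_pXn2r ?nnegrE ?mulr_ge0 ?normc_ge0 //.
lra.
Qed.

Lemma cReV z : Re z^-1 = Re z / normc z ^+ 2.
Proof. by rewrite normc_sqr; case: z. Qed.

(** The real part equals [(1 - |q|^2) / |1 - q|^2], and the denominator is at most 4. *)
Lemma Re_cayley q rho : normc q <= rho -> rho < 1 ->
  (1 - rho) / 4 <= Re ((1 + q) / (1 - q)).
Proof.
move=> qr r1; have q0 := normc_ge0 q.
have d1 : 1 - rho <= normc (1 - q).
  by have := normcB_ge 1 q; rewrite Normc.normc1; lra.
have d2 : normc (1 - q) <= 2.
  by have := le_normcD 1 (- q); rewrite normcN Normc.normc1; lra.
have nz : 1 - q != 0 by rewrite -normc_gt0; lra.
have -> : (1 + q) / (1 - q) = 2%:C * (1 - q)^-1 - 1.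
  by rewrite rmorph_nat; field.
rewrite cReD cReN cReM cReV /= mul0r subr0.
have D0 : 0 < normc (1 - q) ^+ 2 by rewrite exprn_gt0 // normc_gt0.
have -> : 2 * (Re (1 - q) / normc (1 - q) ^+ 2) - 1 =
    (1 - normc q ^+ 2) / normc (1 - q) ^+ 2.
  apply: (mulIf (lt0r_neq0 D0)); rewrite mulrBl mulrA !divfK ?lt0r_neq0 //.
  rewrite !normc_sqr; case: (q) => a b /=; ring.
rewrite ler_pdivlMr //.
have : normc (1 - q) ^+ 2 <= 2 ^+ 2 by rewrite lerXn2r ?nnegrE ?normc_ge0.
have : normc q ^+ 2 <= rho ^+ 2 by rewrite lerXn2r ?nnegrE //; lra.
nra.
Qed.

(** Since [|1 - r|^2 = |1 + r|^2 - 4 Re r] and [|1 + r| <= 1 + M], it suffices that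
    [1 - rho^2 <= 4 d / (1 + M)^2]; the chosen [rho] gives this through
    [1 - rho^2 <= 2 (1 - rho)]. *)
Lemma cayley_bound d M : 0 < d -> d <= M -> 1 <= M ->
  exists2 rho, 0 <= rho /\ rho < 1 & forall r, d <= Re r -> normc r <= M ->
    1 + r != 0 /\ normc ((1 - r) / (1 + r)) <= rho.
Proof.
move=> d0 dM M1; pose rho := 1 - 2 * d / (1 + M) ^+ 2.
have D0 : 0 < (1 + M) ^+ 2 by rewrite exprn_gt0 //; lra.
have rho1 : rho < 1 by rewrite /rho ltrBlDr ltrDl divr_gt0 // mulr_gt0.
have rho0 : 0 <= rho by rewrite /rho subr_ge0 ler_pdivrMr // mul1r; nra.
exists rho => // r dr rM.
have nz : 1 + r != 0.
  rewrite -normc_gt0; apply: lt_le_trans (le_trans (ler_norm _) (Re_le_normc _)).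
  by rewrite cReD /=; lra.
split=> //; have n0 : 0 < normc (1 + r) by rewrite normc_gt0.
rewrite Normc.normcM Normc.normcV ler_pdivrMr //.
rewrite -(ler_pXn2r (n:=2)) ?nnegrE ?normc_ge0 ?mulr_ge0 ?normc_ge0 // exprMn.
have hD : normc (1 + r) ^+ 2 <= (1 + M) ^+ 2.
  rewrite lerXn2r ?nnegrE ?normc_ge0 //; first lra.
  by apply: le_trans (le_normcD _ _) _; rewrite Normc.normc1 lerD2l.
have -> : normc (1 - r) ^+ 2 = normc (1 + r) ^+ 2 - 4 * Re r.
  by rewrite !normc_sqr; case: (r) => a b /=; ring.
have : (1 - rho ^+ 2) * normc (1 + r) ^+ 2 <= 4 * d.
  apply: le_trans (_ : 2 * (1 - rho) * (1 + M) ^+ 2 <= _).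
    apply: ler_pM => //; [nra|exact: sqr_ge0|nra].
  have -> : 1 - rho = 2 * d / (1 + M) ^+ 2 by rewrite /rho; ring.
  by rewrite -[2 * (_ / _) * _]mulrA divfK ?gt_eqF //; lra.
lra.
Qed.

End SlitPlane.

(** * Inverses and zeros of functions with values in a slit plane *)

Section HullSqrt.
Variables (R : realType) (T : Type) (A : set (T -> R[i])) (K : set T) (x : T).
Hypothesis HA : hull_algebra A K x.
Implicit Types (f g r p : T -> R[i]) (y : T) (s d k e : R).
Local Notation Y := (fun y => K y \/ y = x).

Lemma hull_shift f e : A f -> A (fun y => f y + e%:C).
Proof. by move=> Af; exact: (hull_add HA Af (hull_const HA e%:C)). Qed.

Lemma hull_inv_slit f k e : A f -> 0 < k -> (forall y, K y -> slit k (f y)) ->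
  0 < e -> A (fun y => (f y + e%:C)^-1) /\
  (forall y, Y y -> k * e <= normc (f y + e%:C)).
Proof.
move=> Af k0 fk e0.
have fke y s : K y -> 0 <= s -> k * e <= normc (f y + e%:C + s%:C).
  move=> Ky s0; rewrite -addrA -rmorphD; apply: le_trans (fk _ Ky _ _).
    by rewrite ler_pM2l // lerDl.
  by rewrite addr_ge0 // ltW.
have [h1 h2] := hull_inv_ray HA (hull_shift e Af) (mulr_gt0 k0 e0) fke (lexx 0).
split; last by move=> y /h2; rewrite addr0.
by apply: (hull_ext HA h1) => y _; rewrite addr0.
Qed.

(** The function [(f + s)^-1] belongs to the algebra and is at most [(k s)^-1] over [K], hence at
    [x]: nothing is lost in [k]. *)
Lemma hull_slit f k : A f -> 0 < k -> (forall y, K y -> slit k (f y)) ->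
  forall y, Y y -> slit k (f y).
Proof.
move=> Af k0 fk y Yy s; rewrite le_eqVlt => /predU1P[<-|s0].
  by rewrite mulr0 normc_ge0.
exact: (hull_inv_slit Af k0 fk s0).2.
Qed.

(* [e / (f + e)] peaks at the zeros of [f] as [e] tends to 0. *)
Lemma hull_zero f p k c : A f -> A p -> 0 < k -> 0 <= c ->
  (forall y, K y -> slit k (f y)) ->
  (forall y, K y -> normc (p y) ^+ 2 <= c * normc (f y)) ->
  f x = 0 -> p x = 0.
Proof.
move=> Af Ap k0 c0 fk pf fx0; apply: Normc.eq0_normc; apply/eqP.
rewrite eq_le normc_ge0 andbT; apply/ler_addgt0Pr => e e0; rewrite add0r.
pose D := c * ((k + 2) / k) ^+ 2 + 1.
have D0 : 0 < D by rewrite ltr_wpDl // mulr_ge0 // sqr_ge0.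
(* From [|p|^2 <= c |f|] and [|f| + h <= (k + 2) / k |f + h|] one gets
   [|p h / (f + h)|^2 <= h D = e^2] over [K]. At [x] the factor [h / (f + h)] equals 1. *)
pose h := e ^+ 2 / D.
have h0 : 0 < h by rewrite divr_gt0 // exprn_gt0.
have [Ai _] := hull_inv_slit Af k0 fk h0.
have Ag := hull_mul HA Ap (hull_scale HA h%:C Ai).
have : normc (p x * (h%:C * (f x + h%:C)^-1)) <= e.
  apply: (hull_bound HA Ag) => y Ky.
  rewrite -(ler_pXn2r (n:=2)) ?nnegrE ?normc_ge0 ?(ltW e0) //.
  rewrite !Normc.normcM Normc.normcV normc_real gtr0_norm //.
  have hF := slit_ge (ltW k0) (fk y Ky) (ltW h0).
  have hP := pf y Ky.
  set F := normc (f y) in hF hP *; set P := normc (p y) in hP *.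
  set G := normc (f y + h%:C) in hF *.
  have F0 : 0 <= F by exact: normc_ge0.
  have G0 : 0 < G.
    rewrite -(pmulr_rgt0 _ (_ : 0 < k + 2)); last lra.
    by apply: lt_le_trans hF; rewrite mulr_gt0 //; lra.
  have -> : (P * (h * G^-1)) ^+ 2 = P ^+ 2 * h ^+ 2 / G ^+ 2.
    by field; rewrite gt_eqF.
  rewrite ler_pdivrMr ?exprn_gt0 //.
  have e2 : e ^+ 2 = h * D by rewrite /h divfK // gt_eqF.
  have hG : (F + h) <= (k + 2) / k * G by rewrite mulrAC ler_pdivlMr // mulrC.
  have hG2 : (F + h) ^+ 2 <= ((k + 2) / k) ^+ 2 * G ^+ 2.
    rewrite -exprMn lerXn2r ?nnegrE //; first lra.
    by apply: le_trans hG; lra.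
  rewrite e2; apply: le_trans (_ : c * F * h ^+ 2 <= _).
    by rewrite ler_wpM2r // sqr_ge0.
  apply: le_trans (_ : h * (c * (F + h) ^+ 2) <= _).
    rewrite -subr_ge0.
    have -> : h * (c * (F + h) ^+ 2) - c * F * h ^+ 2 =
      c * h * (F ^+ 2 + F * h + h ^+ 2) by ring.
    apply: mulr_ge0; first exact: mulr_ge0 c0 (ltW h0).
    by rewrite !addr_ge0 ?sqr_ge0 // mulr_ge0 // ltW.
  rewrite -[h * D * _]mulrA ler_pM2l // /D mulrDl mul1r -mulrA.
  by rewrite ler_wpDr ?sqr_ge0 // ler_wpM2l.
by rewrite fx0 add0r divff ?mulr1 // -normc_gt0 normc_real normr_gt0 gt_eqF.
Qed.

End HullSqrt.

(** * Square roots by Newton's iteration *)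

Section HullSqrtNewton.
Variables (R : realType) (T : Type) (A : set (T -> R[i])) (K : set T) (x : T).
Hypothesis HA : hull_algebra A K x.
Implicit Types (f g r : T -> R[i]) (y : T) (s d k e : R).
Local Notation Y := (fun y => K y \/ y = x).

(* Newton's iterates for [sqrt g] started at 1 are [r (1 + q ^ N) / (1 - q ^ N)]
   with [N = 2 ^ n] and [q] the Cayley transform of [r]. *)
Lemma hull_sqrt_pos g r d : A g -> (forall y, Y y -> r y ^+ 2 = g y) -> 0 < d ->
  (forall y, Y y -> d <= Re (r y)) -> A r.
Proof.
move=> Ag rg d0 dr.
have [M0 M00 gM] := hull_boundedY HA Ag.
pose M := 1 + M0.
have rM y : Y y -> normc (r y) <= M.
  move=> Yy; rewrite -(ler_pXn2r (n:=2)) ?nnegrE ?normc_ge0 //; last by rewrite /M; lra.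
  by rewrite -normcX rg //; apply: le_trans (gM _ Yy) _; rewrite /M; nra.
have dM : d <= M.
  apply: le_trans (rM x (or_intror erefl)); apply: le_trans (dr x (or_intror erefl)) _.
  exact: le_trans (ler_norm _) (Re_le_normc _).
have M1 : 1 < M by rewrite /M; lra.
have [rho [rho0 rho1] cayley] := cayley_bound d0 dM (ltW M1).
pose q y := (1 - r y) / (1 + r y).
have r1nz y : Y y -> 1 + r y != 0.
  by move=> Yy; exact: (cayley _ (dr y Yy) (rM y Yy)).1.
have qr y : Y y -> normc (q y) <= rho.
  by move=> Yy; exact: (cayley _ (dr y Yy) (rM y Yy)).2.
have rnz y : Y y -> r y != 0.
  move=> Yy; rewrite -normc_gt0; apply: lt_le_trans (le_trans (ler_norm _) (Re_le_normc _)).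
  exact: lt_le_trans (dr y Yy).
pose h n y := r y * ((1 + q y ^+ (2 ^ n)) / (1 - q y ^+ (2 ^ n))).
have qn n y : Y y -> normc (q y ^+ (2 ^ n)) <= rho ^+ (2 ^ n).
  by move=> Yy; rewrite normcX lerXn2r ?nnegrE ?normc_ge0 // qr.
have qrho n y : Y y -> normc (q y ^+ (2 ^ n)) <= rho.
  move=> Yy; apply: le_trans (qn n y Yy) _; rewrite -[leRHS]expr1.
  by apply: ler_wiXn2l; rewrite ?expn_gt0 // ltW.
have q1n n y : Y y -> 1 - rho <= normc (1 - q y ^+ (2 ^ n)).
  move=> Yy; have := normcB_ge 1 (q y ^+ (2 ^ n)); have := qrho n y Yy.
  by rewrite Normc.normc1; lra.
have q1nz n y : Y y -> 1 - q y ^+ (2 ^ n) != 0.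
  by move=> /(q1n n) hq; rewrite -normc_gt0; apply: lt_le_trans hq; lra.
have q2nz n y : Y y -> 1 + q y ^+ (2 ^ n) != 0.
  move=> Yy; rewrite -normc_gt0; have := normcD_ge 1 (q y ^+ (2 ^ n)).
  by have := qrho n y Yy; rewrite Normc.normc1; lra.
have hA n : A (h n).
  elim: n => [|n IH].
    apply: (hull_ext HA (hull_const HA 1)) => y Yy.
    rewrite /h expn0 expr1 /q; have := r1nz y Yy; have := rnz y Yy => h1 h2.
    field; rewrite h2 /=; have -> : 1 + r y - (1 - r y) = 2 * r y by ring.
    by rewrite mulf_neq0 ?pnatr_eq0.
  have d'0 : 0 < d * ((1 - rho) / 4) by rewrite mulr_gt0 // divr_gt0 // subr_gt0.
  (* Factor out [r]: what remains is [(1 + q ^ N) / (1 - q ^ N) + s / r], whose first term has real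
     part at least [(1 - rho) / 4] and whose second has nonnegative real part. *)
  have hray y s : K y -> 0 <= s -> d * ((1 - rho) / 4) <= normc (h n y + s%:C).
    move=> Ky s0; have Yy : Y y by left.
    have -> : h n y + s%:C =
        r y * ((1 + q y ^+ (2 ^ n)) / (1 - q y ^+ (2 ^ n)) + s%:C * (r y)^-1).
      by rewrite mulrDr [r y * (_ * _)]mulrCA divff ?rnz // mulr1.
    rewrite Normc.normcM; apply: ler_pM; [exact: ltW|by rewrite divr_ge0 // subr_ge0 ltW| |].
      exact: le_trans (dr y Yy) (le_trans (ler_norm _) (Re_le_normc _)).
    apply: le_trans (le_trans (ler_norm _) (Re_le_normc _)).
    rewrite cReD ler_wpDr ?Re_cayley ?qrho //.
    rewrite cReM cReV /= mul0r subr0 mulr_ge0 // divr_ge0 ?sqr_ge0 //.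
    exact: le_trans (ltW d0) (dr y Yy).
  have [hi _] := hull_inv_ray HA IH d'0 hray (lexx 0).
  (* Newton's step [(h + g / h) / 2] squares [q ^ N]. *)
  apply: (hull_ext HA (hull_scale HA (2^-1) (hull_add HA IH (hull_mul HA Ag hi)))) => y Yy.
  rewrite addr0 -rg // /h expnS mulnC exprM.
  have := q1nz n y Yy; have := q2nz n y Yy; have := rnz y Yy.
  have := q1nz n.+1 y Yy; rewrite expnS mulnC exprM.
  move: (q y ^+ (2 ^ n)) => Q h0 h1 h2 h3.
  by field; rewrite h0 h1 h2 h3.
apply: (hull_closed HA) => e e0.
have [n hn] : exists n, rho ^+ n <= e * (1 - rho) / (2 * M).
  apply: expr_small => //; rewrite divr_gt0 ?mulr_gt0 ?subr_gt0 //; lra.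
exists (h n) => // y Yy.
have -> : r y - h n y = - 2%:C * r y * q y ^+ (2 ^ n) / (1 - q y ^+ (2 ^ n)).
  by rewrite rmorph_nat /h; have := q1nz n y Yy => h1; field.
rewrite !Normc.normcM Normc.normcV normcN normc_real gtr0_norm //.
rewrite ler_pdivrMr ?normc_gt0 ?q1nz //.
apply: le_trans (_ : e * (1 - rho) <= _); last by rewrite ler_pM2l ?q1n.
have h1 : normc (q y ^+ (2 ^ n)) <= e * (1 - rho) / (2 * M).
  apply: le_trans hn; apply: le_trans (qn n y Yy) _.
  by apply: expr2n_le => //; exact: ltW.
have MM : 0 < 2 * M by lra.
apply: le_trans (_ : 2 * M * (e * (1 - rho) / (2 * M)) <= _).
  apply: ler_pM; rewrite ?mulr_ge0 ?normc_ge0 // ler_pM2l // rM //.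
by rewrite mulrC divfK // gt_eqF.
Qed.

(** The root may touch the imaginary axis at zeros of [f], so [f] is first shifted by [E]. The root
    of [f + E] has real part at least [E / e], and the two roots differ by [E] divided by their sum,
    hence by at most [e]. *)
Lemma hull_sqrtc f k : A f -> 0 < k -> (forall y, K y -> slit k (f y)) ->
  A (fun y => sqrtc (f y)).
Proof.
move=> Af k0 /(hull_slit HA Af k0) fk; apply: (hull_closed HA) => e e0.
(* This value makes [(E / e)^2 = (k / 2)^2 (k E)], the lower bound that [slit_sqrt] gives. *)
pose E := e ^+ 2 * k ^+ 3 / 4.
have E0 : 0 < E by rewrite /E divr_gt0 // mulr_gt0 // exprn_gt0.
have rE y : Y y -> E / e <= Re (sqrtc (f y + E%:C)).
  move=> Yy; have fkE := slit_shift (ltW k0) (fk y Yy) (ltW E0).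
  rewrite -[_ + _]sqr_sqrtc in fkE.
  have h1 := slit_sqrt (ltW k0) fkE (Re_sqrtc_ge0 _).
  have h2 : k * E <= normc (sqrtc (f y + E%:C)) ^+ 2.
    by rewrite -normcX sqr_sqrtc; exact: fk (ltW E0).
  apply: le_trans h1.
  rewrite -(ler_pXn2r (n:=2)) ?nnegrE ?mulr_ge0 ?normc_ge0 ?invr_ge0 ?(ltW E0) ?(ltW e0) ?(ltW k0) //.
  rewrite [leRHS]exprMn; apply: le_trans (_ : (k / 2) ^+ 2 * (k * E) <= _).
    rewrite /E le_eqVlt; apply/orP; left; apply/eqP; field; exact: lt0r_neq0.
  by rewrite ler_wpM2l // sqr_ge0.
exists (fun y => sqrtc (f y + E%:C)).
  apply: (@hull_sqrt_pos (fun y => f y + E%:C) _ (E / e)) => //.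
  - exact: (hull_shift HA).
  - by move=> y _; rewrite sqr_sqrtc.
  - exact: divr_gt0.
move=> y Yy; have h1 := rE y Yy; have h2 := Re_sqrtc_ge0 (f y).
set a := sqrtc (f y) in h2 *; set b := sqrtc (f y + E%:C) in h1 *.
have ab0 : E / e <= normc (a + b).
  apply: le_trans (le_trans (ler_norm _) (Re_le_normc _)); rewrite cReD; lra.
have Ee : 0 < E / e by exact: divr_gt0.
have : normc (a - b) * normc (a + b) = E.
  rewrite -Normc.normcM -subr_sqr /a /b !sqr_sqrtc.
  by rewrite opprD addrA subrr add0r normcN normc_real gtr0_norm.
move=> h3; rewrite -(ler_pM2r Ee).
have -> : e * (E / e) = E by rewrite mulrC divfK // gt_eqF.
by rewrite -[leRHS]h3 ler_wpM2l ?normc_ge0.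
Qed.

End HullSqrtNewton.

(* Newton's iteration for the sign function: it squares the Cayley transform
   [(1 - z) / (1 + z)], and it preserves sectors around the real axis. *)
Definition sign_step (R : realType) (z : R[i]) : R[i] := 2 * z / (1 + z ^+ 2).

(** * Invariant sectors and convergence of the sign iteration *)

Section SignIteration.
Variable R : realType.
Implicit Types (z : R[i]) (k e : R) (n : nat).
Local Notation N n := (iter n (@sign_step R)).

Lemma sign_iterN n z : N n (- z) = - N n z.
Proof.
elim: n => //= n ->; rewrite /sign_step sqrrN.
by rewrite mulrN mulNr.
Qed.

Lemma Re_sign_step z :
  Re (sign_step z) = 2 * Re z * (1 + normc z ^+ 2) / normc (1 + z ^+ 2) ^+ 2.
Proof.
rewrite /sign_step cReM cReV.
have -> : Im (1 + z ^+ 2)^-1 = - Im (z ^+ 2) / normc (1 + z ^+ 2) ^+ 2.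
  rewrite normc_sqr; case: z => a b; rewrite expr2 /=.
  by rewrite !add0r mulNr.
rewrite mulrA mulrA -mulrBl; congr (_ / _).
by rewrite normc_sqr; case: z => a b; rewrite expr2 /=; ring.
Qed.

Lemma normc_sign_step z :
  normc (sign_step z) = 2 * normc z / normc (1 + z ^+ 2).
Proof.
rewrite /sign_step !Normc.normcM Normc.normcV; congr (_ * _ / _).
by rewrite -(rmorph_nat (real_complex R)) normc_real ger0_norm.
Qed.

(** One step multiplies [|Re z| / |z|] by [(1 + |z|^2) / |1 + z^2| >= 1]. Where [1 + z^2 = 0], the
    default inverse makes both sides 0. *)
Lemma sign_step_cone k z :
  k * normc z <= `|Re z| -> k * normc (sign_step z) <= `|Re (sign_step z)|.
Proof.
move=> kz; rewrite Re_sign_step normc_sign_step.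
set P := normc (1 + z ^+ 2); have P0 : 0 <= P by exact: normc_ge0.
have PZ : P <= 1 + normc z ^+ 2.
  by apply: le_trans (le_normcD _ _) _; rewrite Normc.normc1 normcX.
have [->|Pn] := eqVneq P 0; first by rewrite invr0 !mulr0 normr_ge0.
have Pp : 0 < P by rewrite lt_def Pn.
have Z0 : 0 <= normc z by exact: normc_ge0.
have -> : `|2 * Re z * (1 + normc z ^+ 2) / P ^+ 2| =
    2 * `|Re z| * (1 + normc z ^+ 2) / P ^+ 2.
  have h1 : 0 <= 1 + normc z ^+ 2 by rewrite addr_ge0 ?sqr_ge0.
  by rewrite !normrM normfV normrX (ger0_norm P0) (ger0_norm h1) normr_nat.
rewrite -subr_ge0.
have -> : 2 * `|Re z| * (1 + normc z ^+ 2) / P ^+ 2 - k * (2 * normc z / P) =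
  2 * (`|Re z| * (1 + normc z ^+ 2) - k * normc z * P) / P ^+ 2 by field.
apply: divr_ge0; last exact: sqr_ge0.
apply: mulr_ge0 => //; rewrite subr_ge0.
apply: le_trans (_ : `|Re z| * P <= _); first by rewrite ler_wpM2r.
by rewrite ler_wpM2l.
Qed.

Lemma sign_iter_cone k z n :
  k * normc z <= `|Re z| -> k * normc (N n z) <= `|Re (N n z)|.
Proof. by move=> kz; elim: n => //= n; exact: sign_step_cone. Qed.

(** The identity [|1 + z^2|^2 - 4 (Re z)^2 = (1 - |z|^2)^2] gives
    [|1 + z^2| >= 2 |Re z| >= 2 k |z|]. *)
Lemma sign_step_bound k z : 0 < k ->
  k * normc z <= `|Re z| -> normc (sign_step z) <= k^-1.
Proof.
move=> k0 kz; rewrite normc_sign_step.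
set P := normc (1 + z ^+ 2); have P0 : 0 <= P by exact: normc_ge0.
have [->|Pn] := eqVneq P 0; first by rewrite invr0 mulr0 invr_ge0 ltW.
have Pp : 0 < P by rewrite lt_def Pn.
rewrite ler_pdivrMr // ler_pdivlMl //.
rewrite -(ler_pXn2r (n:=2)) ?nnegrE ?mulr_ge0 ?normc_ge0 ?(ltW k0) //.
have kz2 : (k * normc z) ^+ 2 <= `|Re z| ^+ 2.
  by rewrite lerXn2r ?nnegrE ?mulr_ge0 ?normc_ge0 ?(ltW k0).
rewrite real_normK ?num_real // in kz2.
have -> : (k * (2 * normc z)) ^+ 2 = 4 * (k * normc z) ^+ 2 by ring.
apply: le_trans (_ : 4 * Re z ^+ 2 <= _); first by rewrite ler_pM2l.
rewrite /P normc_sqr -subr_ge0.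
have -> : Re (1 + z ^+ 2) ^+ 2 + Im (1 + z ^+ 2) ^+ 2 - 4 * Re z ^+ 2 =
    (1 - normc z ^+ 2) ^+ 2.
  by rewrite normc_sqr; case: z {kz kz2 P P0 Pn Pp} => a b; rewrite expr2 /=; ring.
exact: sqr_ge0.
Qed.

Lemma sign_iter_bound k z n : 0 < k ->
  k * normc z <= `|Re z| -> normc (N n z) <= normc z + k^-1.
Proof.
move=> k0 kz; case: n => [|n] /=.
  by rewrite lerDl invr_ge0 ltW.
apply: le_trans (sign_step_bound k0 (sign_iter_cone _ kz)) _.
by rewrite lerDr normc_ge0.
Qed.

Lemma sign_iter_cvg d M e : 0 < d -> d <= M -> 0 < e ->
  exists n, forall z, d <= Re z -> normc z <= M -> normc (1 - N n z) <= e.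
Proof.
move=> d0 dM e0.
have [||rho [rho0 rho1] cayley] := @cayley_bound R d (1 + M) d0; [lra|lra|].
have [n hn] : exists n, rho ^+ n <= e * (1 - rho) / 2.
  by apply: expr_small => //; rewrite divr_gt0 ?mulr_gt0 ?subr_gt0.
exists n => z dz zM.
have [|nz qr] := cayley z dz; first lra.
set q := (1 - z) / (1 + z) in qr.
have qn m : normc (q ^+ (2 ^ m)) <= rho ^+ (2 ^ m).
  by rewrite normcX lerXn2r ?nnegrE ?normc_ge0.
have q1nz m : 1 + q ^+ (2 ^ m) != 0.
  rewrite -normc_gt0; have := normcD_ge 1 (q ^+ (2 ^ m)); rewrite Normc.normc1.
  have : rho ^+ (2 ^ m) <= rho ^+ 1.
    by apply: ler_wiXn2l; rewrite ?expn_gt0 // ltW.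
  by rewrite expr1; have := qn m; lra.
have NE m : N m z = (1 - q ^+ (2 ^ m)) / (1 + q ^+ (2 ^ m)).
  elim: m => [|m IH].
    rewrite /= expn0 expr1 /q; field; rewrite nz /=.
    have -> : 1 + z + (1 - z) = 2 by ring.
    by rewrite pnatr_eq0.
  rewrite iterS IH /sign_step expnS mulnC exprM.
  have := q1nz m; have := q1nz m.+1; rewrite expnS mulnC exprM.
  move: (q ^+ (2 ^ m)) => Q h1 h2; field.
  rewrite h1 h2 /=.
  have -> : (1 + Q) ^+ 2 + (1 - Q) ^+ 2 = 2 * (1 + Q ^+ 2) by ring.
  by rewrite mulf_neq0 ?pnatr_eq0.
rewrite NE.
have -> : 1 - (1 - q ^+ (2 ^ n)) / (1 + q ^+ (2 ^ n)) =
    2 * q ^+ (2 ^ n) / (1 + q ^+ (2 ^ n)).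
  by have := q1nz n => h1; field.
rewrite !Normc.normcM Normc.normcV ler_pdivrMr ?normc_gt0 //.
rewrite -(rmorph_nat (real_complex R)) normc_real ger0_norm //.
have h1 : normc (q ^+ (2 ^ n)) <= e * (1 - rho) / 2.
  apply: le_trans hn; apply: le_trans (qn n) _.
  by apply: expr2n_le => //; exact: ltW.
have h2 : 1 - rho <= normc (1 + q ^+ (2 ^ n)).
  have := normcD_ge 1 (q ^+ (2 ^ n)); rewrite Normc.normc1.
  have : rho ^+ (2 ^ n) <= rho ^+ 1.
    by apply: ler_wiXn2l; rewrite ?expn_gt0 // ltW.
  by rewrite expr1; have := qn n; lra.
apply: le_trans (_ : e * (1 - rho) <= _); first lra.
by rewrite ler_pM2l.
Qed.

(** A double sector around the real axis avoids the imaginary axis, so its two quarter turns avoid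
    the negative real axis. *)
Lemma cone_slit k z : 0 <= k -> k * normc z <= `|Re z| ->
  slit (k / (1 + k)) ('i%C * z) /\ slit (k / (1 + k)) (- 'i%C * z).
Proof.
move=> k0 kz; split; apply: slit_of_ray => // s s0;
  apply: le_trans (Im_le_normc _); rewrite Normc.normcM ?normcN;
  rewrite {1}/normc /= expr0n expr1n add0r sqrtr1 mul1r;
  apply: le_trans kz _; case: z => a b /=.
  by rewrite mul0r add0r mul1r addr0.
by rewrite !oppr0 mul0r add0r mulN1r addr0 normrN.
Qed.

(** With [s = r = |z|] and [b = Im z], the two conditions become [k^2 r <= 2 (r - b)] and
    [k^2 r <= 2 (r + b)]. Multiplying one of them by the larger of [r - b], [r + b] gives
    [k^2 r^2 <= 2 (Re z)^2]. *)
Lemma slit_cone k z : 0 < k -> k <= 1 -> slit k ('i%C * z) -> slit k (- 'i%C * z) ->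
  k ^+ 2 / 2 * normc z <= `|Re z|.
Proof.
move=> k0 k1 /(_ _ (normc_ge0 z)) h1 /(_ _ (normc_ge0 z)) h2.
have n2 := normc_sqr z; have n0 := normc_ge0 z.
rewrite -(ler_pXn2r (n:=2)) ?nnegrE ?mulr_ge0 ?normc_ge0 ?(ltW k0) //.
rewrite real_normK ?num_real //.
have sq (u v : R) : 0 <= u -> u <= v -> u ^+ 2 <= v ^+ 2.
  by move=> u0 uv; rewrite lerXn2r ?nnegrE // (le_trans u0).
move: {h1}(sq _ _ (mulr_ge0 (ltW k0) n0) h1) {h2}(sq _ _ (mulr_ge0 (ltW k0) n0) h2).
rewrite !(normc_sqr (_ + _)).
move: (normc z) n2 n0 => r; case: z => a b /= n2 n0.
rewrite !oppr0 !mul0r !mul1r !mulN1r !add0r !addr0 opprK sqrrN.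
have k2 : k ^+ 2 <= 1 by rewrite expr_le1 // ltW.
have k20 : 0 <= k ^+ 2 by exact: sqr_ge0.
rewrite !exprMn !exprVn; move: (k ^+ 2) k2 k20 => K k2 k20.
move=> h1 h2.
have [->|rnz] := eqVneq r 0; first by rewrite expr0n mulr0 sqr_ge0.
have rp : 0 < r by rewrite lt_def rnz.
have g1 : K * r <= 2 * (r + b).
  by rewrite -(ler_pM2r rp); nra.
have g2 : K * r <= 2 * (r - b).
  by rewrite -(ler_pM2r rp); nra.
have : (K * r) * r <= 2 * a ^+ 2 by case: (lerP 0 b) => b0; nra.
nra.
Qed.

End SignIteration.

(** * Kallin's lemma *)

Definition in_hull (R : realType) (T : Type) (A : set (T -> R[i])) (K : set T) (x : T) :=
  forall f M, A f -> (forall y, K y -> normc (f y) <= M) -> normc (f x) <= M.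

Section Kallin.
Variables (R : realType) (T : Type) (A : set (T -> R[i])).
Implicit Types (K : set T) (f g t : T -> R[i]) (x y : T) (k e : R).
Local Notation N n := (iter n (@sign_step R)).

(** The denominator factors as [1 + z^2 = (1 + i z) (1 - i z)], and on the cone both factors have
    inverses in the algebra. *)
Lemma hull_sign_iter K x t k n : hull_algebra A K x -> A t -> 0 < k ->
  (forall y, K y -> k * normc (t y) <= `|Re (t y)|) -> A (fun y => N n (t y)).
Proof.
move=> HA At k0 kt; elim: n => [|n IH]; first exact: (hull_ext HA At).
have kn y : K y -> k * normc (N n (t y)) <= `|Re (N n (t y))|.
  by move=> Ky; apply: sign_iter_cone; exact: kt.
have k'0 : 0 < k / (1 + k) by rewrite divr_gt0 //; lra.
have [A1 _] := hull_inv_slit HA (hull_scale HA 'i%C IH) k'0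
  (fun y Ky => (cone_slit (ltW k0) (kn y Ky)).1) ltr01.
have [A2 _] := hull_inv_slit HA (hull_scale HA (- 'i%C) IH) k'0
  (fun y Ky => (cone_slit (ltW k0) (kn y Ky)).2) ltr01.
apply: (hull_ext HA (hull_mul HA (hull_scale HA 2 IH) (hull_mul HA A1 A2))) => y _.
rewrite iterS /sign_step -invfM; congr (_ / _).
have i2 : 'i%C ^+ 2 = -1 :> R[i] := sqr_i R.
move: (N n (t y)) => z.
have -> : ('i%C * z + 1%:C) * (- 'i%C * z + 1%:C) = 1 - 'i%C ^+ 2 * z ^+ 2 :> R[i].
  by rewrite rmorph1; ring.
by rewrite i2; ring.
Qed.

Lemma hull_cone K x t k : hull_algebra A K x -> A t -> 0 < k ->
  (forall y, K y -> k * normc (t y) <= `|Re (t y)|) ->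
  exists2 c, 0 < c & forall y, K y \/ y = x -> c * normc (t y) <= `|Re (t y)|.
Proof.
move=> HA At k0 kt; have k'0 : 0 < k / (1 + k) by rewrite divr_gt0 //; lra.
exists ((k / (1 + k)) ^+ 2 / 2); first by rewrite divr_gt0 // exprn_gt0.
move=> y Yy; apply: slit_cone => //.
- by rewrite ler_pdivrMr; lra.
- exact: (hull_slit HA (hull_scale HA 'i%C At) k'0
    (fun z Kz => (cone_slit (ltW k0) (kt z Kz)).1)).
- exact: (hull_slit HA (hull_scale HA (- 'i%C) At) k'0
    (fun z Kz => (cone_slit (ltW k0) (kt z Kz)).2)).
Qed.

(** The test function is [f^m t (1 + N n t)]. Over [K2] it is small: either [t] is small or [N n t]
    is near -1. Over [K1] it is at most a constant times [M^m], and at [x] its modulus is at least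
    [|f x|^m |t x|]. Letting [m] grow removes the constants. The factor [t] covers the neighbourhood
    of 0, where the iteration does not converge uniformly. *)
Lemma kallin_pos K1 K2 x y1 t k : hull_algebra A (K1 `|` K2) x -> K1 y1 ->
  A t -> 0 < k ->
  (forall y, K1 y -> k * normc (t y) <= Re (t y)) ->
  (forall y, K2 y -> k * normc (t y) <= - Re (t y)) ->
  t x != 0 -> 0 <= Re (t x) -> in_hull A K1 x.
Proof.
move=> HA K1y At k0 t1 t2 tx0 Rx f M Af fM.
have M0 : 0 <= M by exact: le_trans (normc_ge0 _) (fM _ K1y).
have [c c0 tc] : exists2 c, 0 < c &
    forall y, (K1 `|` K2) y \/ y = x -> c * normc (t y) <= `|Re (t y)|.
  apply: (hull_cone HA At k0) => y [/t1 h|/t2 h]; apply: le_trans h _.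
    exact: ler_norm.
  by rewrite -normrN ler_norm.
have [Ct Ct0 tCt] := hull_boundedY HA At.
have [Cf Cf0 fCf] := hull_boundedY HA Af.
pose B := Ct + c^-1.
have B0 : 0 < B by rewrite addr_gt0 // invr_gt0.
have NB n y : (K1 `|` K2) y \/ y = x -> normc (N n (t y)) <= B.
  move=> Yy; apply: le_trans (sign_iter_bound _ c0 (tc y Yy)) _.
  by rewrite lerD2r tCt.
have tx : 0 < normc (t x) by rewrite normc_gt0.
apply: (@le_of_expr_le _ _ _ (normc (t x)) (Ct * (1 + B))) => //.
  exact: normc_ge0.
move=> m; apply/ler_addgt0Pr => e e0.
pose D := Cf ^+ m.
have D0 : 0 < D by exact: exprn_gt0.
(* [eta] separates small from large values of [t], and [e2] is the accuracy of the iteration on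
   large ones; each regime then contributes at most [e / 2] over [K2]. Both depend on [m], which is
   fixed before [n]. *)
pose eta := Num.min (normc (t x)) (e / (2 * D * (1 + B))).
pose e2 := Num.min 1 (e / (2 * D * Ct)).
have eta0 : 0 < eta.
  by rewrite lt_min tx divr_gt0 // !mulr_gt0 //; lra.
have e20 : 0 < e2 by rewrite lt_min ltr01 divr_gt0 // !mulr_gt0.
pose d := Num.min (c * eta) Ct.
have d0 : 0 < d by rewrite lt_min mulr_gt0.
have dCt : d <= Ct by rewrite ge_min lexx orbT.
have [n hn] := sign_iter_cvg d0 dCt e20.
have far y : (K1 `|` K2) y \/ y = x -> eta <= normc (t y) -> d <= `|Re (t y)|.
  move=> Yy ety; apply: le_trans (tc y Yy); rewrite /d ge_min; apply/orP; left.
  by rewrite ler_pM2l.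
have AG := hull_sign_iter n HA At c0 (fun y Ky => tc y (or_introl Ky)).
have Ag := hull_mul HA (hull_mul HA (hull_exp HA m Af) At)
  (hull_add HA (hull_const HA 1) AG).
have e2a : D * (eta * (1 + B)) <= e / 2.
  have : eta <= e / (2 * D * (1 + B)) by rewrite ge_min lexx orbT.
  rewrite ler_pdivlMr; last by rewrite !mulr_gt0 //; lra.
  lra.
have e2b : D * (Ct * e2) <= e / 2.
  have : e2 <= e / (2 * D * Ct) by rewrite ge_min lexx orbT.
  rewrite ler_pdivlMr; last by rewrite !mulr_gt0.
  lra.
have e21 : e2 <= 1 by rewrite ge_min lexx.
have : normc (f x ^+ m * t x * (1 + N n (t x))) <= Ct * (1 + B) * M ^+ m + e.
  apply: (hull_bound HA Ag) => y Ky; rewrite !Normc.normcM normcX.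
  have Yy : (K1 `|` K2) y \/ y = x by left.
  have h1 : normc (1 + N n (t y)) <= 1 + B.
    by apply: le_trans (le_normcD _ _) _; rewrite Normc.normc1 lerD2l NB.
  case: Ky => Ky.
    apply: le_trans (_ : M ^+ m * Ct * (1 + B) <= _); last by lra.
    apply: ler_pM; rewrite ?mulr_ge0 ?exprn_ge0 ?normc_ge0 //.
    apply: ler_pM; rewrite ?exprn_ge0 ?normc_ge0 ?tCt //.
    by rewrite lerXn2r ?nnegrE ?normc_ge0 // fM.
  apply: (@le_trans _ _ e); last first.
    by rewrite lerDr !mulr_ge0 ?exprn_ge0 //; lra.
  rewrite -mulrA.
  have fD : normc (f y) ^+ m <= D by rewrite lerXn2r ?nnegrE ?normc_ge0 ?(ltW Cf0) // fCf.
  have [le_eta|lt_eta] := lerP (normc (t y)) eta.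
    apply: le_trans (_ : D * (eta * (1 + B)) <= _); last lra.
    apply: ler_pM; rewrite ?mulr_ge0 ?exprn_ge0 ?normc_ge0 //.
    by apply: ler_pM; rewrite ?normc_ge0.
  apply: le_trans (_ : D * (Ct * e2) <= _); last lra.
  apply: ler_pM; rewrite ?mulr_ge0 ?exprn_ge0 ?normc_ge0 //.
  apply: ler_pM; rewrite ?normc_ge0 ?tCt //.
  have := hn (- t y); rewrite sign_iterN opprK normcN; apply; last exact: tCt.
  have := far y Yy (ltW lt_eta); have := t2 y Ky; have := normc_ge0 (t y).
  rewrite cReN => h2 h3 /le_trans; apply.
  by rewrite ler0_norm //; have := mulr_ge0 (ltW k0) h2; lra.
have hx : normc (1 - N n (t x)) <= e2.
  apply: hn; last exact: tCt (or_intror erefl).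
  rewrite -[leRHS]ger0_norm //; apply: far; first by right.
  by rewrite ge_min lexx.
have h2 : 1 <= normc (1 + N n (t x)).
  have := normcB_ge 2%:C (1 - N n (t x)); rewrite normc_real ger0_norm //.
  have -> : 2%:C - (1 - N n (t x)) = 1 + N n (t x) by rewrite rmorph_nat; ring.
  lra.
apply: le_trans; rewrite !Normc.normcM normcX -{1}[_ * normc (t x)]mulr1.
by rewrite ler_wpM2l // mulr_ge0 ?exprn_ge0 ?normc_ge0.
Qed.

Lemma kallin K1 K2 x y1 y2 t k : hull_algebra A (K1 `|` K2) x -> K1 y1 -> K2 y2 ->
  A t -> 0 < k ->
  (forall y, K1 y -> k * normc (t y) <= Re (t y)) ->
  (forall y, K2 y -> k * normc (t y) <= - Re (t y)) ->
  t x != 0 -> in_hull A K1 x \/ in_hull A K2 x.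
Proof.
move=> HA K1y K2y At k0 t1 t2 tx0; have [h|h] := lerP 0 (Re (t x)).
  by left; exact: (kallin_pos HA K1y At k0 t1 t2 tx0).
right; rewrite setUC in HA.
have ANt : A (fun y => - t y).
  by apply: (hull_ext HA (hull_scale HA (-1) At)) => y _; rewrite mulN1r.
apply: (kallin_pos HA K2y ANt k0) => [y /t2|y /t1||].
- by rewrite normcN cReN.
- by rewrite normcN cReN opprK.
- by rewrite oppr_eq0.
- by rewrite cReN oppr_ge0 ltW.
Qed.

End Kallin.

(** * Kallin's lemma for a wedge and its complement *)

Section Wedge.
Variables (R : realType) (T : Type) (A : set (T -> R[i])).
Variables (K0 K1 K2 : set T) (x : T) (F : T -> R[i]) (a b k : R).
Hypotheses (a0 : 0 < a) (b0 : 0 < b) (ab1 : a ^+ 2 + b ^+ 2 = 1) (k0 : 0 < k).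
Hypothesis HA : hull_algebra A (K0 `|` (K1 `|` K2)) x.
Hypothesis AF : A F.
Hypothesis F0 : forall y, K0 y ->
  k * normc (F y) <= b * Re (F y) + a * Im (F y) /\
  k * normc (F y) <= b * Re (F y) - a * Im (F y).
Hypothesis F1 : forall y, K1 y -> k * normc (F y) <= a * Im (F y) - b * Re (F y).
Hypothesis F2 : forall y, K2 y -> k * normc (F y) <= - (b * Re (F y) + a * Im (F y)).

(** With [a = cos phi] and [b = sin phi], [mu] is [e^(i phi)]. [F] maps [K0] into the wedge
    [|arg| < phi] and the other sets outside it. The negative axis of [f] is the boundary ray
    [arg F = phi]. *)
Let mu : R[i] := a +i* b.
Let f y := - (a -i* b) * F y.

Let normc_mu : normc mu = 1. Proof. by rewrite /= ab1 sqrtr1. Qed.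

Let normc_f y : normc (f y) = normc (F y).
Proof. by rewrite Normc.normcM normcN {1}/normc sqrrN ab1 sqrtr1 mul1r. Qed.

Let Af : A f. Proof. exact: (hull_scale HA). Qed.

Let Im_f y : Im (f y) = b * Re (F y) - a * Im (F y).
Proof. by rewrite /f; case: (F y) => p q /=; ring. Qed.

Lemma wedge_slit y : (K0 `|` (K1 `|` K2)) y -> slit (k / (1 + k)) (f y).
Proof.
move=> Ky; apply: slit_of_ray => [|s s0]; first exact: ltW.
rewrite normc_f.
have Im_s : Im (f y + s%:C) = b * Re (F y) - a * Im (F y).
  by rewrite cImD Im_f addr0.
case: Ky => [/F0 [_ h]|[/F1 h|/F2 h]].
- by apply: le_trans h _; apply: le_trans (Im_le_normc _); rewrite Im_s ler_norm.
- apply: le_trans h _; apply: le_trans (Im_le_normc _).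
  by rewrite Im_s -normrN opprB ler_norm.
(* Multiplication by [mu ^+ 2] turns [f] into [- mu F], whose imaginary part is bounded below by
   [F2]; the shift adds [s sin (2 phi) = 2 a b s], which is nonnegative. *)
- have -> : normc (f y + s%:C) = normc (mu * (mu * (f y + s%:C))).
    by rewrite !Normc.normcM normc_mu !mul1r.
  apply: le_trans (Im_le_normc _); apply: le_trans (ler_norm _).
  apply: le_trans h _; rewrite /f /mu; case: (F y) => p q /=.
  rewrite -subr_ge0.
  have -> : a * (a * (- a * q + - - b * p + 0) + b * (- a * p - - - b * q + s)) +
      b * (a * (- a * p - - - b * q + s) - b * (- a * q + - - b * p + 0)) -
      - (b * p + a * q) = (a ^+ 2 + b ^+ 2 - 1) * (- (b * p + a * q)) + 2 * a * b * s.
    by ring.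
  by rewrite ab1 subrr mul0r add0r !mulr_ge0 // ltW.
Qed.

Lemma wedge_zero p c : A p -> 0 <= c ->
  (forall y, (K0 `|` (K1 `|` K2)) y -> normc (p y) ^+ 2 <= c * normc (F y)) ->
  F x = 0 -> p x = 0.
Proof.
move=> Ap c0 pF Fx; apply: (hull_zero HA Af Ap _ c0 wedge_slit).
- by rewrite divr_gt0 // addr_gt0.
- by move=> y Ky; rewrite normc_f; exact: pF.
- by rewrite /f Fx mulr0.
Qed.

(* The square root of [- mu^* F], with its cut inside one of the two gaps between
   [F @` K0] and [F @` (K1 `|` K2)], sends the two sides of the other gap into
   opposite half-planes. *)
Lemma kallin_wedge y0 y1 : K0 y0 -> K1 y1 -> F x != 0 ->
  in_hull A K0 x \/ in_hull A (K1 `|` K2) x.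
Proof.
move=> K0y K1y Fx0.
have [kp ap bp abp] : [/\ 0 < k, 0 < a, 0 < b & a ^+ 2 + b ^+ 2 = 1] by [].
have k'0 : 0 < k / (1 + k) by rewrite divr_gt0 // addr_gt0.
have k'k : k / (1 + k) <= k by rewrite ler_pdivrMr; nra.
have a1 : a <= 1.
  by rewrite -(expr_le1 (n:=2)) ?(ltW a0) //; have := sqr_ge0 b; lra.
pose h y := sqrtc (f y).
have h2E y : h y ^+ 2 = f y by exact: sqr_sqrtc.
(* Since [t^2 = - mu F], nonzero values of [t] are imaginary exactly when [F] lies on the ray
   [arg F = - phi], the gap that contains no cut. *)
pose t y := mu * h y.
have At : A t by apply: (hull_scale HA); exact: (hull_sqrtc HA Af k'0 wedge_slit).
pose c := a * (k / (1 + k)) / 2.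
have c0 : 0 < c by rewrite divr_gt0 // mulr_gt0.
have ck : c <= k / 2 by rewrite /c; nra.
have hc y : (K0 `|` (K1 `|` K2)) y -> k / (1 + k) / 2 * normc (h y) <= Re (h y).
  move=> Ky; apply: slit_sqrt; [exact: ltW| |exact: Re_sqrtc_ge0].
  by rewrite h2E; exact: wedge_slit.
have th y : normc (t y) = normc (h y) by rewrite Normc.normcM normc_mu mul1r.
have t2 y : normc (F y) = normc (t y) ^+ 2.
  by rewrite th -normcX h2E normc_f.
have Imh y : 2 * (Re (h y) * Im (h y)) = b * Re (F y) - a * Im (F y).
  by rewrite -Im_f -h2E; case: (h y) => p q; rewrite expr2 /=; ring.
have Imt y : 2 * (Re (t y) * Im (t y)) = - (b * Re (F y) + a * Im (F y)).
  transitivity (Im (mu ^+ 2 * h y ^+ 2)).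
    by rewrite -exprMn -/(t y); case: (t y) => p q; rewrite expr2 /=; ring.
  rewrite h2E /f /mu; case: (F y) => p q; rewrite expr2 /=.
  rewrite -[RHS]mul1r -ab1; ring.
have Ret y : Re (t y) = a * Re (h y) - b * Im (h y).
  by rewrite /t /mu; case: (h y).
have Imt' y : Im (t y) = a * Im (h y) + b * Re (h y).
  by rewrite /t /mu; case: (h y).
have Reh y : Re (h y) = a * Re (t y) + b * Im (t y).
  by rewrite Ret Imt' -[LHS]mul1r -ab1; ring.
have tn0 y := normc_ge0 (t y).
have Rhn y := Re_sqrtc_ge0 (f y).
have ab y : Im (t y) <= normc (t y) := le_trans (ler_norm _) (Im_le_normc (t y)).
(* Used with [u] equal to [Re t] or to its opposite: as [Im t <= |t|], a lower bound on [Im (t^2)]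
   becomes one on [u]. *)
have half y u : 0 <= u -> k * normc (t y) ^+ 2 <= 2 * (u * Im (t y)) ->
    c * normc (t y) <= u.
  move=> u0 hu; have [z|nz] := eqVneq (normc (t y)) 0; first by rewrite z mulr0.
  have np : 0 < normc (t y) by rewrite lt_def nz tn0.
  rewrite -(ler_pM2r np); have := ab y; have := tn0 y.
  move: (normc (t y)) hu np => r hu np r0 hr; nra.
have HA' := HA; rewrite setUC in HA'.
have [||||] := kallin HA' (or_introl K1y : (K1 `|` K2) y1) K0y At c0.
- move=> y Ky; have := hc y (or_intror Ky); rewrite -th => hcy.
  have [t0|tnz] := eqVneq (t y) 0; first by rewrite t0 Normc.normc0 mulr0.
  have tp : 0 < normc (t y) by rewrite normc_gt0.
  have hp : 0 < Re (h y) by apply: lt_le_trans hcy; rewrite mulr_gt0 // divr_gt0.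
  case: Ky => [/F1|/F2]; rewrite t2 => hF.
    have : Re (h y) * Im (h y) <= 0.
      by have := Imh y; have := mulr_ge0 (ltW k0) (sqr_ge0 (normc (t y))); lra.
    rewrite pmulr_rle0 // => I0.
    by rewrite Ret; have := ler_wpM2l (ltW a0) hcy; rewrite /c; nra.
  apply: half; last by rewrite Imt.
  (* If [Re t] were negative, [Im t] would be nonpositive, against [Re h = a Re t + b Im t > 0]. *)
  rewrite leNgt; apply/negP => Rn.
  have : 0 <= Re (t y) * Im (t y).
    by have := Imt y; have := mulr_ge0 (ltW k0) (sqr_ge0 (normc (t y))); lra.
  by rewrite nmulr_rge0 // => I0; move: hp; rewrite Reh; nra.
- move=> y Ky; have := hc y (or_introl Ky); rewrite -th => hcy.
  have [t0|tnz] := eqVneq (t y) 0; first by rewrite t0 Normc.normc0 mulr0 oppr0.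
  have tp : 0 < normc (t y) by rewrite normc_gt0.
  have hp : 0 < Re (h y) by apply: lt_le_trans hcy; rewrite mulr_gt0 // divr_gt0.
  have [] := F0 Ky; rewrite t2 => h1 h2.
  have sq0 : 0 < k * normc (t y) ^+ 2 by rewrite mulr_gt0 // exprn_gt0.
  have : 0 < Re (h y) * Im (h y) by have := Imh y; lra.
  rewrite pmulr_rgt0 // => Ip.
  have Itp : 0 < Im (t y) by rewrite Imt' addr_gt0 // mulr_gt0.
  have : Re (t y) * Im (t y) <= 0 by have := Imt y; lra.
  rewrite pmulr_lle0 // => Rt0.
  by apply: half; [rewrite oppr_ge0|rewrite mulNr mulrN Imt opprK].
- apply: contra Fx0 => /eqP tx0; apply/eqP/Normc.eq0_normc.
  by rewrite t2 tx0 Normc.normc0 expr0n.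
- by right.
- by left.
Qed.

End Wedge.

(** * Polynomial hulls *)

Section UniformClosure.
Variables (R : realType) (T : Type) (P : set (T -> R[i])) (K : set T) (x : T).
Implicit Types (f g : T -> R[i]) (e : R).

Definition unif_closure : set (T -> R[i]) := [set f | forall e, 0 < e ->
  exists2 g, P g & forall y, K y \/ y = x -> normc (f y - g y) <= e].

Lemma sub_unif_closure : P `<=` unif_closure.
Proof. by move=> f Pf e e0; exists f => // y _; rewrite subrr Normc.normc0 ltW. Qed.

Lemma hull_algebra_closure :
  (forall c, P (fun=> c)) ->
  (forall f g, P f -> P g -> P (fun y => f y + g y)) ->
  (forall f g, P f -> P g -> P (fun y => f y * g y)) ->
  (forall f, P f -> exists M, forall y, K y -> normc (f y) <= M) ->
  in_hull P K x -> hull_algebra unif_closure K x.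
Proof.
move=> Pc Pa Pm Pb Kx.
have bdd f : unif_closure f ->
    exists2 M, 0 < M & forall y, K y \/ y = x -> normc (f y) <= M.
  move=> /(_ 1 ltr01)[g Pg fg]; have [M gM] := Pb g Pg.
  exists (`|M| + 1 + normc (f x)).
    by rewrite ltr_wpDr ?normc_ge0 // ltr_wpDl.
  move=> y [Ky|->]; last by rewrite lerDr addr_ge0.
  rewrite -(subrK (g y) (f y)); apply: le_trans (le_normcD _ _) _.
  have := fg y (or_introl Ky); have := gM y Ky; have := ler_norm M.
  have := normc_ge0 (f x); lra.
split.
- by move=> c; exact: sub_unif_closure.
- move=> f g Af Ag e e0; have e2 : 0 < e / 2 by rewrite divr_gt0.
  have [f' Pf ff] := Af _ e2; have [g' Pg gg] := Ag _ e2.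
  exists (fun y => f' y + g' y); first exact: Pa.
  move=> y Yy; rewrite opprD addrACA.
  apply: le_trans (le_normcD _ _) _; have := ff y Yy; have := gg y Yy; lra.
- move=> f g Af Ag e e0.
  have [M M0 fM] := bdd f Af; have [M' M'0 gM] := bdd g Ag.
  pose d := Num.min 1 (e / (M + M' + 1)).
  have d0 : 0 < d by rewrite lt_min ltr01 divr_gt0 // !addr_gt0.
  have d1 : d <= 1 by rewrite ge_min lexx.
  have de : d * (M + M' + 1) <= e.
    by rewrite -ler_pdivlMr ?addr_gt0 // ge_min lexx orbT.
  have [f' Pf ff] := Af _ d0; have [g' Pg gg] := Ag _ d0.
  exists (fun y => f' y * g' y); first exact: Pm.
  move=> y Yy.
  have -> : f y * g y - f' y * g' y = f y * (g y - g' y) + (f y - f' y) * g' y by ring.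
  apply: le_trans (le_normcD _ _) _; rewrite !Normc.normcM.
  have g'M : normc (g' y) <= M' + d.
    rewrite -(subKr (g y) (g' y)); apply: le_trans (le_normcD _ _) _.
    by rewrite normcN lerD ?gM ?gg.
  have h1 : normc (f y) * normc (g y - g' y) <= M * d.
    by apply: ler_pM; rewrite ?normc_ge0 ?fM ?gg.
  have h2 : normc (f y - f' y) * normc (g' y) <= d * (M' + d).
    by apply: ler_pM; rewrite ?normc_ge0 ?ff.
  nra.
- by move=> f /bdd[M _ fM]; exists M => y Ky; apply: fM; left.
- move=> f h e e0; have e2 : 0 < e / 2 by rewrite divr_gt0.
  have [g Ag fg] := h _ e2; have [g' Pg gg] := Ag _ e2.
  exists g' => // y Yy; rewrite -(subrKA (g y)).
  apply: le_trans (le_normcD _ _) _; have := fg y Yy; have := gg y Yy; lra.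
- move=> f M Af fM; apply/ler_addgt0Pr => e e0.
  have e2 : 0 < e / 2 by rewrite divr_gt0.
  have [g Pg fg] := Af _ e2.
  have gx : normc (g x) <= M + e / 2.
    apply: Kx => // y Ky; rewrite -(subKr (f y) (g y)).
    apply: le_trans (le_normcD _ _) _; rewrite normcN.
    by have := fg y (or_introl Ky); have := fM y Ky; lra.
  rewrite -(subrK (g x) (f x)); apply: le_trans (le_normcD _ _) _.
  have := fg x (or_intror erefl); lra.
Qed.

End UniformClosure.

(** If [Im (g x) < 0], then [- i (g - Re (g x))] is imaginary over [K], so it satisfies [slit 1]
    there and hence at [x], where its value is the negative number [Im (g x)]: a contradiction. The
    other sign follows by applying this to [- f]. *)
Lemma hull_real (R : realType) (T : Type) (A : set (T -> R[i])) (K : set T) (x : T)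
    (f : T -> R[i]) : hull_algebra A K x -> A f ->
  (forall y, K y -> Im (f y) = 0) -> Im (f x) = 0.
Proof.
move=> HA Af fr.
have below g : A g -> (forall y, K y -> Im (g y) = 0) -> 0 <= Im (g x).
  move=> Ag gr; rewrite leNgt; apply/negP => gx.
  pose h y := - 'i%C * (g y + (- Re (g x))%:C).
  have Ah : A h by apply: (hull_scale HA); exact: (hull_shift HA).
  have : slit 1 (h x).
    apply: (hull_slit HA Ah ltr01) => [y Ky s s0|]; last by right.
    rewrite mul1r /h; apply: le_trans (le_trans (ler_norm _) (Re_le_normc _)).
    by have := gr y Ky; case: (g y) => a b /= ->; lra.
  have ng : 0 <= - Im (g x) by rewrite oppr_ge0 ltW.
  move=> /(_ _ ng); rewrite mul1r /h.
  have -> : - 'i%C * (g x + (- Re (g x))%:C) + (- Im (g x))%:C = 0.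
    by case: (g x) => a b /=; apply/eqP; rewrite eq_complex /=; apply/andP; split; apply/eqP; ring.
  by rewrite Normc.normc0; lra.
apply/eqP; rewrite eq_le below // andbT -oppr_ge0 -cImN.
rewrite -mulN1r; apply: (below (fun y => -1 * f y)); first exact: (hull_scale HA).
by move=> y Ky; rewrite mulN1r cImN fr // oppr0.
Qed.

(** * Polynomial functions and the hulls that they define *)

Section PolynomialFunctions.
Variables (R : realType) (n : nat).
Implicit Types (K : set (Cvec R n)) (f g : Cvec R n -> R[i]).

Definition polyfun : set (Cvec R n -> R[i]) :=
  [set f | exists p : mpoly.mpoly n R[i],
     forall z : Cvec R n, f z = mpoly.meval (z 0) p].

Lemma polyfun_const c : polyfun (fun=> c).
Proof. by exists (mpoly.mpolyC n c) => z; rewrite mpoly.mevalC. Qed.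

Lemma polyfun_coord i : polyfun (fun z : Cvec R n => z 0 i).
Proof. by exists (mpoly.mpolyX R[i] (mpoly.mnm1 i)) => z; rewrite mpoly.mevalXU. Qed.

Lemma polyfun_add f g : polyfun f -> polyfun g -> polyfun (fun z => f z + g z).
Proof. by move=> [p fp] [q gq]; exists (p + q) => z; rewrite fp gq mpoly.mevalD. Qed.

Lemma polyfun_mul f g : polyfun f -> polyfun g -> polyfun (fun z => f z * g z).
Proof. by move=> [p fp] [q gq]; exists (p * q) => z; rewrite fp gq mpoly.mevalM. Qed.

Lemma polyfun_bounded K f r : polyfun f ->
  (forall (z : Cvec R n) i, K z -> normc (z 0 i) <= r) ->
  exists M, forall z, K z -> normc (f z) <= M.
Proof.
move=> [p fp] Kr.
suff [M hM] : exists M, forall z, K z -> normc (mpoly.meval (z 0) p) <= M.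
  by exists M => z Kz; rewrite fp; exact: hM.
elim/mpoly.mpolyind: p {fp} => [|c m p _ _ [M hM]].
  by exists 0 => z _; rewrite mpoly.meval0 Normc.normc0.
exists (normc c * (\prod_(i < n) r ^+ m i) + M) => z Kz.
rewrite mpoly.mevalD mpoly.mevalZ mpoly.mevalX.
apply: le_trans (le_normcD _ _) _; rewrite Normc.normcM lerD ?hM //.
rewrite ler_wpM2l ?normc_ge0 //.
rewrite (big_morph (@normc R) (@Normc.normcM R) (@Normc.normc1 R)).
apply: ler_prod => i _; rewrite normc_ge0 normcX lerXn2r ?nnegrE ?normc_ge0 ?Kr //.
exact: le_trans (normc_ge0 _) (Kr z i Kz).
Qed.

Lemma in_hull_poly K x : poly_hull K x -> in_hull polyfun K x.
Proof.
move=> Kx f M [p fp] fM; rewrite -lee_fin fp; apply: le_trans (Kx p) _.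
apply: ge_ereal_sup => _ [y Ky <-]; rewrite lee_fin /absp -fp; exact: fM.
Qed.

Lemma poly_hull_sub K : K `<=` poly_hull K.
Proof. by move=> x Kx p; apply: ereal_sup_ubound; exists x. Qed.

End PolynomialFunctions.

(** * The three planes *)

Section Planes.
Variable R : realType.
Implicit Types (v : Cvec R 2) (c t a b k : R) (m z X : R[i]).

Definition plane c m : set (Cvec R 2) :=
  [set v : Cvec R 2 | v 0 1 + c%:C * v 0 0 = m * ((v 0 0)^*%C + c%:C * v 0 0)].

Local Notation s := (Num.sqrt 3 : R).
Definition omega : R[i] := (- (1 / 2)) +i* (s / 2).
Definition omegac : R[i] := (- (1 / 2)) -i* (s / 2).

Lemma s2 : s ^+ 2 = 3. Proof. by rewrite sqr_sqrtr. Qed.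

Lemma s_gt0 : 0 < s. Proof. by rewrite sqrtr_gt0. Qed.

Lemma omega_sqr : omega ^+ 2 = omegac.
Proof.
rewrite expr2; apply/eqP; rewrite eq_complex /=; apply/andP; split; apply/eqP; last by field.
by have := s2; rewrite expr2 => h; lra.
Qed.

Lemma omegac_sqr : omegac ^+ 2 = omega.
Proof.
rewrite expr2; apply/eqP; rewrite eq_complex /=; apply/andP; split; apply/eqP; last by field.
by have := s2; rewrite expr2 => h; lra.
Qed.

Lemma P0_plane c : @P0 R = plane c 1.
Proof.
apply/seteqP; split => v; rewrite /P0 /plane /= mul1r; first by move=> ->.
by move/addIr.
Qed.

(** Here [- s (s - i) / 2 = omega - 1] and [- (1 - i s) / 2 = omega], so the equation reads
    [w = omega conj z + (omega - 1) z / t]. *)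
Lemma P1_plane t : t != 0 -> P1 t = plane t^-1 omega.
Proof.
move=> t0.
have tC : (t^-1)%:C = (t%:C)^-1 :> R[i] by exact: fmorphV.
have tC0 : t%:C != 0 :> R[i] by rewrite eq_complex /= negb_and t0.
have sC : (s%:C : R[i]) ^+ 2 = 3 by rewrite -rmorphXn s2 rmorph_nat.
have oE : omega = ('i%C * s%:C - 1) / 2.
  apply: (mulIf (_ : (2 : R[i]) != 0)); rewrite ?pnatr_eq0 // divfK ?pnatr_eq0 //.
  rewrite mulr_natr mulr2n.
  by apply/eqP; rewrite eq_complex /=; apply/andP; split; apply/eqP; lra.
apply/seteqP; split => v; rewrite /P1 /plane /= tC oE -/(real_complex R) => h.
  rewrite h.
  transitivity ((t%:C)^-1 * v 0 0 * (1 - (s%:C) ^+ 2 / 2 + s%:C * 'i%C / 2) -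
    (1 - 'i%C * s%:C) / 2 * (v 0 0)^*%C).
    by field.
  by rewrite sC; field.
apply: (addIr ((t%:C)^-1 * v 0 0)); rewrite h.
transitivity ((t%:C)^-1 * v 0 0 * (1 - (s%:C) ^+ 2 / 2 + s%:C * 'i%C / 2) -
  (1 - 'i%C * s%:C) / 2 * (v 0 0)^*%C).
  by rewrite sC; field.
by field.
Qed.

Lemma P2_plane t : t != 0 -> P2 t = plane t^-1 omegac.
Proof.
move=> t0.
have tC : (t^-1)%:C = (t%:C)^-1 :> R[i] by exact: fmorphV.
have tC0 : t%:C != 0 :> R[i] by rewrite eq_complex /= negb_and t0.
have sC : (s%:C : R[i]) ^+ 2 = 3 by rewrite -rmorphXn s2 rmorph_nat.
have oE : omegac = (- 'i%C * s%:C - 1) / 2.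
  apply: (mulIf (_ : (2 : R[i]) != 0)); rewrite ?pnatr_eq0 // divfK ?pnatr_eq0 //.
  rewrite mulr_natr mulr2n.
  by apply/eqP; rewrite eq_complex /=; apply/andP; split; apply/eqP; lra.
apply/seteqP; split => v; rewrite /P2 /plane /= tC oE -/(real_complex R) => h.
  rewrite h.
  transitivity ((t%:C)^-1 * v 0 0 * (1 - (s%:C) ^+ 2 / 2 - s%:C * 'i%C / 2) -
    (1 + 'i%C * s%:C) / 2 * (v 0 0)^*%C).
    by field.
  by rewrite sC; field.
apply: (addIr ((t%:C)^-1 * v 0 0)); rewrite h.
transitivity ((t%:C)^-1 * v 0 0 * (1 - (s%:C) ^+ 2 / 2 - s%:C * 'i%C / 2) -
  (1 + 'i%C * s%:C) / 2 * (v 0 0)^*%C).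
  by rewrite sC; field.
by field.
Qed.

(** The constant is determinant over trace, a lower bound for the smallest eigenvalue; the
    inequality follows by completing the square. *)
Lemma quadratic_form_ge (al be ga : R) : 0 < al -> be ^+ 2 < al * ga ->
  exists2 k, 0 < k & forall x y,
    k * (x ^+ 2 + y ^+ 2) <= al * x ^+ 2 + ga * y ^+ 2 + 2 * be * (x * y) /\
    k * (x ^+ 2 + y ^+ 2) <= al * x ^+ 2 + ga * y ^+ 2 - 2 * be * (x * y).
Proof.
move=> al0 h; have ga0 : 0 < ga.
  by rewrite -(pmulr_rgt0 _ al0); apply: le_lt_trans h; exact: sqr_ge0.
have ag : 0 < al + ga by exact: addr_gt0.
pose k := (al * ga - be ^+ 2) / (al + ga).
have kE : k * (al + ga) = al * ga - be ^+ 2 by rewrite divfK // gt_eqF.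
exists k; first by rewrite divr_gt0 // subr_gt0.
have ka : 0 < al - k.
  rewrite -(pmulr_lgt0 _ ag) mulrBl kE.
  have -> : al * (al + ga) - (al * ga - be ^+ 2) = al ^+ 2 + be ^+ 2 by ring.
  by rewrite ltr_wpDr ?sqr_ge0 // exprn_gt0.
have main (d x y : R) : d ^+ 2 = be ^+ 2 ->
    k * (x ^+ 2 + y ^+ 2) + 2 * d * (x * y) <= al * x ^+ 2 + ga * y ^+ 2.
  move=> db; rewrite -subr_ge0 -(pmulr_rge0 _ ka).
  have -> : (al - k) * (al * x ^+ 2 + ga * y ^+ 2 -
      (k * (x ^+ 2 + y ^+ 2) + 2 * d * (x * y))) =
    ((al - k) * x - d * y) ^+ 2 + (al * ga - k * (al + ga) + k ^+ 2 - d ^+ 2) * y ^+ 2.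
    by ring.
  rewrite kE db addr_ge0 ?sqr_ge0 // mulr_ge0 ?sqr_ge0 //.
  have -> : al * ga - (al * ga - be ^+ 2) + k ^+ 2 - be ^+ 2 = k ^+ 2 by ring.
  exact: sqr_ge0.
move=> x y; split; last by rewrite lerBrDr; exact: main.
by have := main (- be) x y (sqrrN _); rewrite mulrN mulNr lerBlDr.
Qed.

End Planes.

(** * Values of quadratic forms on the three planes *)

Section Quadrics.
Variable R : realType.
Implicit Types (v : Cvec R 2) (c t a b k : R) (m z X : R[i]).
Local Notation s := (Num.sqrt 3 : R).
Local Notation N v := (normc (v 0 0) ^+ 2).

Definition quadric c a b (v : Cvec R 2) : R[i] :=
  v 0 0 * (v 0 1 + c%:C * v 0 0) + a%:C * v 0 0 ^+ 2 +
  b%:C * (v 0 1 + c%:C * v 0 0) ^+ 2.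

Lemma quadric_plane c a b m v : plane c m v ->
  let u := (v 0 0)^*%C + c%:C * v 0 0 in
  quadric c a b v =
    m * (v 0 0 * u) + a%:C * v 0 0 ^+ 2 + b%:C * (m ^+ 2 * u ^+ 2).
Proof. by rewrite /plane /quadric /= => ->; ring. Qed.

Lemma normc_omega : normc (omega R) = 1.
Proof.
rewrite /= (_ : _ + _ = 1) ?sqrtr1 // sqrrN !exprMn s2.
by rewrite exprVn; field.
Qed.

Lemma normc_omegac : normc (omegac R) = 1.
Proof. by rewrite -omega_sqr normcX normc_omega expr1n. Qed.

Lemma normc_conj z : normc z^*%C = normc z.
Proof. by case: z => p q /=; rewrite sqrrN. Qed.

Lemma plane_bound c m v : 0 <= c -> c <= 1 -> normc m = 1 -> plane c m v ->
  normc (v 0 1 + c%:C * v 0 0) <= 2 * normc (v 0 0).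
Proof.
move=> c0 c1 m1 ->; rewrite Normc.normcM m1 mul1r; apply: le_trans (le_normcD _ _) _.
rewrite normc_conj Normc.normcM normc_real ger0_norm //.
have := normc_ge0 (v 0 0); nra.
Qed.

Lemma quadric_bound c a b m v : 0 <= c -> c <= 1 -> normc m = 1 -> plane c m v ->
  normc (quadric c a b v) <= (2 + `|a| + 4 * `|b|) * N v.
Proof.
move=> c0 c1 m1 /(plane_bound c0 c1 m1).
suff key (w z : R[i]) : normc w <= 2 * normc z ->
    normc (z * w + a%:C * z ^+ 2 + b%:C * w ^+ 2) <=
      (2 + `|a| + 4 * `|b|) * normc z ^+ 2 by exact: key.
move=> wz.
have z0 := normc_ge0 z; have w0 := normc_ge0 w.
apply: le_trans (le_normcD _ _) _; rewrite mulrDl; apply: lerD.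
  apply: le_trans (le_normcD _ _) _; rewrite mulrDl; apply: lerD.
    rewrite Normc.normcM (_ : 2 * _ = normc z * (2 * normc z)); last by ring.
    by rewrite ler_wpM2l.
  by rewrite Normc.normcM normcX normc_real.
rewrite Normc.normcM normcX normc_real [4 * _]mulrC -mulrA.
rewrite ler_wpM2l // (_ : 4 * _ = (2 * normc z) ^+ 2); last by ring.
by rewrite lerXn2r ?nnegrE // mulr_ge0.
Qed.

(** The left side is [Im (e^(-i pi/6) omega X)] and [e^(-i pi/6) omega = i]. The three companions
    are also rotations by [pi/6] in one direction or the other. *)
Lemma Im_omega X : (s / 2) * Im (omega R * X) - 1 / 2 * Re (omega R * X) = Re X.
Proof.
case: X => p q; rewrite /omega /=.
transitivity (p * (1 + s ^+ 2) / 4); first by field.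
by rewrite s2; field.
Qed.

Lemma Im_omegac X :
  (s / 2) * Im (omegac R * X) - 1 / 2 * Re (omegac R * X) = - (Re X + s * Im X) / 2.
Proof.
case: X => p q; rewrite /omegac /=.
transitivity ((p * (1 - s ^+ 2) - 2 * s * q) / 4); first by field.
by rewrite s2; field.
Qed.

Lemma Im_omegac' X :
  (s / 2) * Im (omegac R * X) + 1 / 2 * Re (omegac R * X) = - Re X.
Proof.
case: X => p q; rewrite /omegac /=.
transitivity (- p * (1 + s ^+ 2) / 4); first by field.
by rewrite s2; field.
Qed.

Lemma Im_omega' X :
  (s / 2) * Im (omega R * X) + 1 / 2 * Re (omega R * X) = (Re X - s * Im X) / 2.
Proof.
case: X => p q; rewrite /omega /=.
transitivity ((p * (s ^+ 2 - 1) - 2 * s * q) / 4); first by field.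
by rewrite s2; field.
Qed.

(** These are the wedge conditions with [al = cos phi] and [be = sin phi]. The gap is measured by
    [|z|^2], which dominates the quadric on each plane up to a constant. *)
Definition separates c a b al be k := forall v,
  [/\ plane c 1 v -> k * N v <= be * Re (quadric c a b v) + al * Im (quadric c a b v),
      plane c 1 v -> k * N v <= be * Re (quadric c a b v) - al * Im (quadric c a b v),
      plane c (omega R) v ->
        k * N v <= al * Im (quadric c a b v) - be * Re (quadric c a b v) &
      plane c (omegac R) v ->
        k * N v <= - (be * Re (quadric c a b v) + al * Im (quadric c a b v))].

(** On the plane of factor [m] the quadric is [m X] with [X = |z|^2 + c z^2], so
    [|arg X| <= arcsin c < pi/3] for nonzero [z]. Factors 1, [omega], [omegac] then give disjoint
    sectors. *)
Lemma separates_far c : 0 < c -> c ^+ 2 < 3 / 4 ->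
  exists2 k, 0 < k & separates c 0 0 (1 / 2) (s / 2) k.
Proof.
move=> c0 c2; have c1 : c < 1 by nra.
have sp := s_gt0 R; have ss := s2 R.
have [] := @quadratic_form_ge R (s / 2 * (1 + c)) (c / 2) (s / 2 * (1 - c)).
- by rewrite mulr_gt0 ?divr_gt0 //; lra.
- have -> : s / 2 * (1 + c) * (s / 2 * (1 - c)) = s ^+ 2 / 4 * (1 - c ^+ 2) by field.
  by rewrite ss expr_div_n; lra.
move=> k k0 kP; exists k => // v.
have key v' : k * N v' <= s / 2 * Re (v' 0 0 * ((v' 0 0)^*%C + c%:C * v' 0 0)) +
      1 / 2 * Im (v' 0 0 * ((v' 0 0)^*%C + c%:C * v' 0 0)) /\
    k * N v' <= s / 2 * Re (v' 0 0 * ((v' 0 0)^*%C + c%:C * v' 0 0)) -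
      1 / 2 * Im (v' 0 0 * ((v' 0 0)^*%C + c%:C * v' 0 0)).
  rewrite normc_sqr; case: (v' 0 0) => x y /=; have [h1 h2] := kP x y.
  split; [apply: le_trans h1 _|apply: le_trans h2 _];
    by rewrite le_eqVlt; apply/orP; left; apply/eqP; field.
have [k1 k2] := key v.
have qE m : plane c m v -> quadric c 0 0 v = m * (v 0 0 * ((v 0 0)^*%C + c%:C * v 0 0)).
  by move=> /(quadric_plane 0 0) ->; rewrite rmorph0; ring.
move: (v 0 0 * _) k1 k2 qE => X k1 k2 qE.
split=> /qE ->.
- by rewrite mul1r.
- by rewrite mul1r.
- apply: le_trans k1 _; rewrite le_eqVlt; apply/orP; left; apply/eqP.
  case: X {k2 qE} => p q; rewrite /omega /=.
  transitivity ((s * p + q + (s ^+ 2 - 1) / 2 * q - q) / 2); first by rewrite ss; field.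
  by field.
- apply: le_trans k2 _; rewrite le_eqVlt; apply/orP; left; apply/eqP.
  case: X {k1 qE} => p q; rewrite /omegac /=.
  transitivity ((s * p - q - (s ^+ 2 - 1) / 2 * q + q) / 2); first by rewrite ss; field.
  by field.
Qed.

(** The conclusion is definiteness of the form on the first plane. At [e = 0] it reads
    [3 (3 c - 2 / c)^2 < 9 - 9 c^2], that is [12 c^4 - 15 c^2 + 4 < 0]; being strict, it survives a
    small [e]. *)
Lemma near_parameter c : 0 < c -> c < 1 -> 3 / 4 <= c ^+ 2 ->
  12 * c ^+ 4 - 15 * c ^+ 2 + 4 < 0 ->
  exists2 e, 0 < e &
    let m := 3 - 2 * c * e in
    let p := 3 * c - 3 / 2 * e * c ^+ 2 in
    let q := 3 * c - 2 * c^-1 + e * (2 - 3 / 2 * c ^+ 2) in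
    0 < m + p /\ 3 * q ^+ 2 < m ^+ 2 - p ^+ 2.
Proof.
move=> c0 c1 c34 cthr.
have cnz : c != 0 by rewrite gt_eqF.
pose t := c^-1.
have ct : c * t = 1 by rewrite divff.
have t0 : 0 < t by rewrite invr_gt0.
pose d := 45 - 36 * c ^+ 2 - 12 * t ^+ 2.
have d0 : 0 < d.
  have : 0 < c ^+ 2 * d.
    have -> : c ^+ 2 * d = - (3 * (12 * c ^+ 4 - 15 * c ^+ 2 + 4)).
      by rewrite /d /t; field.
    lra.
  by rewrite pmulr_rgt0 // exprn_gt0.
have t1 : 1 < t by rewrite invf_gt1.
have t2 : t ^+ 2 <= 4 / 3.
  have : c ^+ 2 * t ^+ 2 = 1 by rewrite -exprMn ct expr1n.
  by have := sqr_ge0 t; nra.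
have d6 : d <= 6 by rewrite /d; nra.
(* [d] is the gap at [e = 0]. The bounds below on [m^2], [p^2] and [3 q^2] lose [12 e], [3 e] and
   [9 e], in total less than [d = 100 e]. *)
pose e := d / 100.
have e0 : 0 < e by rewrite divr_gt0.
have e1 : e <= 1 / 10 by rewrite /e; lra.
pose m := 3 - 2 * c * e.
pose p := 3 * c - 3 / 2 * e * c ^+ 2.
pose q := 3 * c - 2 * t + e * (2 - 3 / 2 * c ^+ 2).
have m2 : 9 - 12 * e <= m ^+ 2.
  have -> : m ^+ 2 = 9 - 12 * (c * e) + 4 * (c * e) ^+ 2 by rewrite /m; ring.
  by have := sqr_ge0 (c * e); nra.
have c2 : c ^+ 2 <= 1 by rewrite expr_le1 // ltW.
have p2 : p ^+ 2 <= 9 * c ^+ 2 + 3 * e.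
  have -> : p ^+ 2 = 9 * c ^+ 2 - 9 * (e * c ^+ 3) + 9 / 4 * (e * c ^+ 2) ^+ 2.
    by rewrite /p; field.
  have : 0 <= e * c ^+ 3 by rewrite mulr_ge0 ?exprn_ge0 // ltW.
  have : (e * c ^+ 2) ^+ 2 <= e.
    have h1 : 0 <= e * c ^+ 2 by rewrite mulr_ge0 ?sqr_ge0 // ltW.
    have h2 : e * c ^+ 2 <= e by rewrite -[leRHS]mulr1 ler_wpM2l // ltW.
    nra.
  lra.
have q2 : q ^+ 2 <= (3 * c - 2 * t) ^+ 2 + 3 * e.
  have h1 : 3 * c - 2 * t <= 1 by lra.
  have h2 : 0 <= 3 * c - 2 * t.
    have : 0 <= c * (3 * c - 2 * t).
      have -> : c * (3 * c - 2 * t) = 3 * c ^+ 2 - 2 * (c * t) by ring.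
      by rewrite ct; lra.
    by rewrite pmulr_rge0.
  have -> : q ^+ 2 = (3 * c - 2 * t) ^+ 2 + 2 * e * ((3 * c - 2 * t) * (2 - 3 / 2 * c ^+ 2))
      + e ^+ 2 * (2 - 3 / 2 * c ^+ 2) ^+ 2 by rewrite /q; ring.
  have r0 : 0 <= 2 - 3 / 2 * c ^+ 2 by lra.
  have r1 : 2 - 3 / 2 * c ^+ 2 <= 1 by lra.
  move: (2 - _) r0 r1 => r r0 r1; move: (3 * c - 2 * t) h1 h2 => u h1 h2.
  have : u * r <= 1 by nra.
  have : r ^+ 2 <= 1 by rewrite expr_le1.
  have : e ^+ 2 <= e by nra.
  have := sqr_ge0 r; nra.
have mpq : 3 * q ^+ 2 < m ^+ 2 - p ^+ 2.
  have dE : d = 9 - 9 * c ^+ 2 - 3 * (3 * c - 2 * t) ^+ 2.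
    by rewrite /d /t; field.
  have : d = 100 * e by rewrite /e; field.
  lra.
have mp : 0 < m + p.
  have : c * e <= e by rewrite -[leRHS]mul1r ler_wpM2r // ltW.
  have : e * c ^+ 2 <= e by rewrite -[leRHS]mulr1 ler_wpM2l // ltW.
  by rewrite /m /p; lra.
by exists e.
Qed.

(* At [e = 0] the quadric is real on the second and third planes, up to the unit
   factors [e^(i pi/6)] and [e^(-i pi/6)]; the condition on [c] says that it maps
   the first plane between these two lines. *)
Lemma separates_near c : 0 < c -> c < 1 -> 3 / 4 <= c ^+ 2 ->
  12 * c ^+ 4 - 15 * c ^+ 2 + 4 < 0 ->
  exists a b k, 0 < k /\ separates c a b (s / 2) (1 / 2) k.
Proof.
move=> c0 c1 c34 cthr.
have sp := s_gt0 R; have ss := s2 R.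
have cnz : c != 0 by rewrite gt_eqF.
have c2 : c ^+ 2 <= 1 by rewrite expr_le1 // ltW.
have [e e0] := near_parameter c0 c1 c34 cthr.
set m := 3 - _; set p := 3 * c - _; set q := _ + e * _ => -[mp mpq].
pose t := c^-1.
pose a := c - t + e * (1 - c ^+ 2 / 2).
pose b := t - e.
have [||k0 k00 k0P] := @quadratic_form_ge R ((m + p) / 2) (s / 2 * q) ((m - p) / 2).
- by rewrite divr_gt0.
- rewrite exprMn expr_div_n ss; lra.
(* On the last two planes the form is zero at [e = 0] and linear in [e], so it is [e] times a fixed
   form, definite because [3 c^2 / 4 < 1]. *)
have [||k1 k10 k1P] := @quadratic_form_ge R (e * (c + 3 / 4 * c ^+ 2)) (e * (s * c ^+ 2 / 4))
    (e * (c - 3 / 4 * c ^+ 2)).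
- by rewrite mulr_gt0 // addr_gt0 // mulr_gt0 // exprn_gt0.
- have -> : (e * (s * c ^+ 2 / 4)) ^+ 2 = e ^+ 2 * (s ^+ 2 * c ^+ 4 / 16) by field.
  have -> : e * (c + 3 / 4 * c ^+ 2) * (e * (c - 3 / 4 * c ^+ 2)) =
    e ^+ 2 * (c ^+ 2 - 9 / 16 * c ^+ 4) by field.
  rewrite ltr_pM2l ?exprn_gt0 // ss.
  have -> : c ^+ 4 = c ^+ 2 * c ^+ 2 by ring.
  by have := c34; move: (c ^+ 2) c2 => C c2 h; nra.
have ReR (r : R) (X : R[i]) : Re (r%:C * X) = r * Re X.
  by case: X => ? ? /=; rewrite mul0r subr0.
have ImR (r : R) (X : R[i]) : Im (r%:C * X) = r * Im X.
  by case: X => ? ? /=; rewrite mul0r addr0.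
exists a, b, (Num.min k0 k1); split; first by rewrite lt_min k00.
move=> v; have N0 : 0 <= N v by exact: sqr_ge0.
have kk0 : Num.min k0 k1 * N v <= k0 * N v by rewrite ler_wpM2r // ge_min lexx.
have kk1 : Num.min k0 k1 * N v <= k1 * N v by rewrite ler_wpM2r // ge_min lexx orbT.
split=> /(quadric_plane a b) ->; rewrite !(cReD, cImD).
- apply: le_trans kk0 _; rewrite !(ReR, ImR) !expr1n !mul1r normc_sqr.
  case: (v 0 0) => x y; rewrite !expr2 /= -!expr2; apply: le_trans (k0P x y).1 _.
  rewrite le_eqVlt; apply/orP; left; apply/eqP; rewrite /m /p /q /a /b /t; field.
  exact: cnz.
- apply: le_trans kk0 _; rewrite !(ReR, ImR) !expr1n !mul1r normc_sqr.
  case: (v 0 0) => x y; rewrite !expr2 /= -!expr2; apply: le_trans (k0P x y).2 _.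
  rewrite le_eqVlt; apply/orP; left; apply/eqP; rewrite /m /p /q /a /b /t; field.
  exact: cnz.
- apply: le_trans kk1 _; rewrite omega_sqr !(ReR a, ImR a, ReR b, ImR b) normc_sqr.
  set Z := v 0 0 * _; set U := (_ + _ : R[i]) ^+ 2.
  have -> : s / 2 * (Im (omega R * Z) + a * Im (v 0 0 ^+ 2) + b * Im (omegac R * U)) -
      1 / 2 * (Re (omega R * Z) + a * Re (v 0 0 ^+ 2) + b * Re (omegac R * U)) =
    (s / 2 * Im (omega R * Z) - 1 / 2 * Re (omega R * Z)) +
    a * (s / 2 * Im (v 0 0 ^+ 2) - 1 / 2 * Re (v 0 0 ^+ 2)) +
    b * (s / 2 * Im (omegac R * U) - 1 / 2 * Re (omegac R * U)) by ring.
  rewrite Im_omega Im_omegac /Z /U.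
  case: (v 0 0) => x y; rewrite !expr2 /= -!expr2; apply: le_trans (k1P x y).1 _.
  rewrite le_eqVlt; apply/orP; left; apply/eqP; rewrite /a /b /t; field.
  exact: cnz.
- apply: le_trans kk1 _; rewrite omegac_sqr !(ReR a, ImR a, ReR b, ImR b) normc_sqr.
  set Z := v 0 0 * _; set U := (_ + _ : R[i]) ^+ 2.
  have -> : - (1 / 2 * (Re (omegac R * Z) + a * Re (v 0 0 ^+ 2) + b * Re (omega R * U)) +
      s / 2 * (Im (omegac R * Z) + a * Im (v 0 0 ^+ 2) + b * Im (omega R * U))) =
    - (s / 2 * Im (omegac R * Z) + 1 / 2 * Re (omegac R * Z)) -
    a * (s / 2 * Im (v 0 0 ^+ 2) + 1 / 2 * Re (v 0 0 ^+ 2)) -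
    b * (s / 2 * Im (omega R * U) + 1 / 2 * Re (omega R * U)) by ring.
  rewrite Im_omegac' Im_omega' /Z /U.
  case: (v 0 0) => x y; rewrite !expr2 /= -!expr2; apply: le_trans (k1P x y).2 _.
  rewrite le_eqVlt; apply/orP; left; apply/eqP; rewrite /a /b /t; field.
  exact: cnz.
Qed.

End Quadrics.

(** * The hull of pieces of the three planes *)

Section HullOfPlanes.
Variable R : realType.
Implicit Types (K : set (Cvec R 2)) (v x : Cvec R 2) (c t a b k r : R) (m : R[i]).
Local Notation s := (Num.sqrt 3 : R).

Definition coord_bounded r K := forall (v : Cvec R 2) i, K v -> normc (v 0 i) <= r.

Lemma hull_algebra_poly K r x : coord_bounded r K ->
  in_hull (@polyfun R 2) K x -> hull_algebra (unif_closure (@polyfun R 2) K x) K x.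
Proof.
move=> Kr Kx; apply: hull_algebra_closure Kx.
- exact: polyfun_const.
- exact: polyfun_add.
- exact: polyfun_mul.
- by move=> f Pf; exact: (polyfun_bounded Pf Kr).
Qed.

Lemma polyfun_shear c : polyfun (fun v : Cvec R 2 => v 0 1 + c%:C * v 0 0).
Proof.
apply: polyfun_add; first exact: polyfun_coord.
by apply: polyfun_mul; [exact: polyfun_const|exact: polyfun_coord].
Qed.

Lemma polyfun_quadric c a b : polyfun (quadric c a b).
Proof.
have [z w] := (polyfun_coord R (0 : 'I_2), polyfun_shear c).
apply: polyfun_add; first apply: polyfun_add.
- exact: polyfun_mul.
- by apply: polyfun_mul; [exact: polyfun_const|exact: polyfun_mul].
- by apply: polyfun_mul; [exact: polyfun_const|exact: polyfun_mul].
Qed.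

(* [z + v] and [i (z - v)], with [v = m^-1 w' - c z], are real where [v = conj z]. *)
Lemma hull_plane K r c m x : coord_bounded r K -> m != 0 -> K `<=` plane c m ->
  in_hull (@polyfun R 2) K x -> plane c m x.
Proof.
move=> Kr m0 Km Kx; have HA := hull_algebra_poly Kr Kx.
pose u (y : Cvec R 2) : R[i] := m^-1 * (y 0 1 + c%:C * y 0 0) + (- c)%:C * y 0 0.
have Pu : polyfun u.
  apply: polyfun_add; apply: polyfun_mul; try exact: polyfun_const.
    exact: polyfun_shear.
  exact: polyfun_coord.
have Pz := polyfun_coord R (0 : 'I_2).
have Pf : polyfun (fun y : Cvec R 2 => y 0 0 + u y) by exact: polyfun_add.
have Pg : polyfun (fun y : Cvec R 2 => 'i%C * (y 0 0 + (-1) * u y)).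
  apply: polyfun_mul; first exact: polyfun_const.
  by apply: polyfun_add => //; apply: polyfun_mul => //; exact: polyfun_const.
have uE y : plane c m y <-> u y = (y 0 0)^*%C.
  suff key (z w : R[i]) : w + c%:C * z = m * (z^*%C + c%:C * z) <->
      m^-1 * (w + c%:C * z) + (- c)%:C * z = z^*%C by exact: key.
  rewrite rmorphN mulNr; split => [->|<-]; first by rewrite mulKf // addrK.
  by rewrite subrK mulVKf.
have re y : K y -> Im (y 0 0 + u y) = 0.
  by move=> /Km/uE ->; case: (y 0 0) => p q /=; rewrite subrr.
have im y : K y -> Im ('i%C * (y 0 0 + (-1) * u y)) = 0.
  by move=> /Km/uE ->; case: (y 0 0) => p q /=; ring.
have := hull_real HA (@sub_unif_closure _ _ _ K x _ Pf) re.
have := hull_real HA (@sub_unif_closure _ _ _ K x _ Pg) im.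
rewrite -/(plane c m x) => h1 h2; apply/uE; move: h1 h2.
case: (u x) (x 0 0) => p q [p' q'] /= h1 h2.
by apply/eqP; rewrite eq_complex /=; apply/andP; split; apply/eqP; lra.
Qed.

Lemma separates_exists c : 0 < c -> c < 1 ->
  c ^+ 2 < 3 / 4 \/ 12 * c ^+ 4 - 15 * c ^+ 2 + 4 < 0 ->
  exists a b al be k, [/\ 0 < al, 0 < be, al ^+ 2 + be ^+ 2 = 1, 0 < k &
    separates c a b al be k].
Proof.
move=> c0 c1 h; have sp := s_gt0 R; have ss := s2 R.
have [c34|c34] := ltrP (c ^+ 2) (3 / 4).
  have [k k0 hk] := separates_far c0 c34.
  exists 0, 0, (1 / 2), (s / 2), k; split; [lra|lra| |exact: k0|exact: hk].
  by rewrite !expr_div_n ss; field.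
case: h => [h|h]; first by move: c34; rewrite leNgt h.
have [a [b [k [k0 hk]]]] := separates_near c0 c1 c34 h.
exists a, b, (s / 2), (1 / 2), k; split; [lra|lra| |exact: k0|exact: hk].
by rewrite !expr_div_n ss; field.
Qed.

Lemma plane_coord_le c m v : 0 <= c -> c <= 1 -> normc m = 1 -> plane c m v ->
  normc (v 0 1) ^+ 2 <= 9 * normc (v 0 0) ^+ 2.
Proof.
move=> c0 c1 m1 /(plane_bound c0 c1 m1) h.
have -> : 9 * normc (v 0 0) ^+ 2 = (3 * normc (v 0 0)) ^+ 2 by ring.
have z0 := normc_ge0 (v 0 0).
rewrite lerXn2r ?nnegrE ?normc_ge0 ?mulr_ge0 //.
have := normcD_ge (v 0 1) (c%:C * v 0 0).
rewrite Normc.normcM normc_real ger0_norm //.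
have : c * normc (v 0 0) <= 1 * normc (v 0 0) by rewrite ler_wpM2r.
rewrite mul1r => h1 h2; apply: le_trans (_ : 2 * normc (v 0 0) + c * normc (v 0 0) <= _).
  by rewrite -lerBlDr; exact: le_trans h2 h.
lra.
Qed.

(** The term [(c / 2) z^2] cancels the contribution of [Re omega = - 1 / 2], leaving the imaginary
    parts [s / 2 (|z|^2 + c Re (z^2))] and its opposite. *)
Lemma separated_slices c : 0 < c -> c < 1 ->
  exists2 k, 0 < k & forall v,
    (plane c (omega R) v ->
      k * normc (v 0 0) ^+ 2 <= Im (quadric c (c / 2) 0 v)) /\
    (plane c (omegac R) v ->
      k * normc (v 0 0) ^+ 2 <= - Im (quadric c (c / 2) 0 v)).
Proof.
move=> c0 c1; have sp := s_gt0 R.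
exists (s / 2 * (1 - c)); first by rewrite mulr_gt0 ?divr_gt0 // subr_gt0.
have main (x y : R) : s / 2 * (1 - c) * (x ^+ 2 + y ^+ 2) <=
    s / 2 * (1 + c) * x ^+ 2 + s / 2 * (1 - c) * y ^+ 2.
  rewrite -subr_ge0.
  have -> : s / 2 * (1 + c) * x ^+ 2 + s / 2 * (1 - c) * y ^+ 2 -
    s / 2 * (1 - c) * (x ^+ 2 + y ^+ 2) = s * c * x ^+ 2 by field.
  exact: mulr_ge0 (mulr_ge0 (ltW sp) (ltW c0)) (sqr_ge0 x).
move=> v; split => /(quadric_plane (c / 2) 0) ->;
  rewrite rmorph0 mul0r addr0 normc_sqr; case: (v 0 0) => x y; rewrite !expr2 /=;
  apply: le_trans (main x y) _; rewrite -subr_ge0 le_eqVlt; apply/orP; left;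
  by apply/eqP; field.
Qed.

Lemma hull_planes K0 K1 K2 r c x : 0 < c -> c < 1 ->
  c ^+ 2 < 3 / 4 \/ 12 * c ^+ 4 - 15 * c ^+ 2 + 4 < 0 ->
  coord_bounded r (K0 `|` (K1 `|` K2)) -> K0 0 -> K1 0 -> K2 0 ->
  K0 `<=` plane c 1 -> K1 `<=` plane c (omega R) -> K2 `<=` plane c (omegac R) ->
  in_hull (@polyfun R 2) (K0 `|` (K1 `|` K2)) x ->
  [\/ plane c 1 x, plane c (omega R) x | plane c (omegac R) x].
Proof.
move=> c0 c1 hc Kr K00 K10 K20 K0p K1p K2p Kx.
have [c0' c1'] : 0 <= c /\ c <= 1 by split; exact: ltW.
have [[m0 m1] m2] := (@Normc.normc1 R, normc_omega R, normc_omegac R).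
have nz m : normc m = 1 -> m != 0 by move=> h; rewrite -normc_gt0 h.
have origin : x 0 0 = 0 -> x 0 1 = 0 -> plane c 1 x.
  by rewrite /plane /= => -> ->; rewrite mulr0 addr0 rmorph0 addr0 mulr0.
have [a [b [al [be [k [al0 be0 ab1 k0 sep]]]]]] := separates_exists c0 c1 hc.
have HA := hull_algebra_poly Kr Kx.
set A := unif_closure _ _ _ in HA.
have AP f : polyfun f -> A f by exact: sub_unif_closure.
pose F := quadric c a b.
pose C := 2 + `|a| + 4 * `|b|.
have C0 : 0 < C by rewrite /C; have := normr_ge0 a; have := normr_ge0 b; lra.
have FC m v : normc m = 1 -> plane c m v ->
    k / C * normc (F v) <= k * normc (v 0 0) ^+ 2.
  move=> hm /(quadric_bound a b c0' c1' hm) h.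
  by rewrite mulrAC ler_pdivrMr // -mulrA ler_pM2l // mulrC.
have kC : 0 < k / C by exact: divr_gt0.
have F0 y : K0 y -> k / C * normc (F y) <= be * Re (F y) + al * Im (F y) /\
    k / C * normc (F y) <= be * Re (F y) - al * Im (F y).
  move=> /K0p h; have [h1 h2 _ _] := sep y; have h3 := FC _ _ m0 h.
  by split; [exact: le_trans h3 (h1 h)|exact: le_trans h3 (h2 h)].
have F1 y : K1 y -> k / C * normc (F y) <= al * Im (F y) - be * Re (F y).
  by move=> /K1p h; have [_ _ h1 _] := sep y; exact: le_trans (FC _ _ m1 h) (h1 h).
have F2 y : K2 y -> k / C * normc (F y) <= - (be * Re (F y) + al * Im (F y)).
  by move=> /K2p h; have [_ _ _ h1] := sep y; exact: le_trans (FC _ _ m2 h) (h1 h).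
have Fge y : (K0 `|` (K1 `|` K2)) y -> normc (y 0 0) ^+ 2 <= 2 / k * normc (F y).
  move=> Ky; rewrite mulrAC ler_pdivlMr // mulrC.
  have al1 : al <= 1 by have := sqr_ge0 be; nra.
  have be1 : be <= 1 by have := sqr_ge0 al; nra.
  have n0 := normc_ge0 (F y).
  have bnd (p q : R) : `|p| <= normc (F y) -> `|q| <= normc (F y) ->
      be * p + al * q <= 2 * normc (F y).
    move=> hp hq.
    have : be * p <= normc (F y).
      by have := ler_norm p; nra.
    have : al * q <= normc (F y).
      by have := ler_norm q; nra.
    lra.
  have R1 := Re_le_normc (F y); have I1 := Im_le_normc (F y).
  have [h1 _ h3 h4] := sep y.
  case: Ky => [/K0p/h1 h|[/K1p/h3 h|/K2p/h4 h]]; apply: le_trans h _.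
  - exact: bnd.
  - by have := bnd (- Re (F y)) (Im (F y)); rewrite normrN => /(_ R1 I1); rewrite /F; lra.
  - have := bnd (- Re (F y)) (- Im (F y)); rewrite !normrN => /(_ R1 I1); rewrite /F; lra.
have Wge y : (K0 `|` (K1 `|` K2)) y -> normc (y 0 1) ^+ 2 <= 9 * normc (y 0 0) ^+ 2.
  by case=> [/K0p|[/K1p|/K2p]]; exact: plane_coord_le.
have AF : A F by apply: AP; exact: polyfun_quadric.
(* Where [F] vanishes Kallin's lemma says nothing, but [|z|^2] and [|w|^2] are dominated by [|F|] on
   the planes, so both coordinates of [x] vanish. *)
have [Fx0|Fx0] := eqVneq (F x) 0.
  have k20 : 0 <= 2 / k by rewrite divr_ge0 // ltW.
  constructor 1; apply: origin.
    exact: (wedge_zero al0 be0 ab1 kC HA AF F0 F1 F2 (AP _ (polyfun_coord R 0)) k20 Fge).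
  apply: (wedge_zero al0 be0 ab1 kC HA AF F0 F1 F2 (AP _ (polyfun_coord R 1))
    (_ : 0 <= 9 * (2 / k))) => //; first by rewrite mulr_ge0.
  by move=> y Ky; apply: le_trans (Wge y Ky) _; rewrite -mulrA ler_pM2l // Fge.
have [h|h] := kallin_wedge al0 be0 ab1 kC HA AF F0 F1 F2 K00 K10 Fx0.
  constructor 1; apply: (@hull_plane K0 r) => //; first by move=> v i Kv; apply: Kr; left.
  by move=> f M Pf; exact: h (AP _ Pf).
(* Now [x] is in the hull of the last two pieces alone, and the uniform closure is rebuilt over
   them. *)
have {}Kx : in_hull (@polyfun R 2) (K1 `|` K2) x by move=> f M Pf; exact: h (AP _ Pf).
have {}Kr : coord_bounded r (K1 `|` K2) by move=> v i Kv; apply: Kr; right.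
move: {HA AF AP A h} (hull_algebra_poly Kr Kx); set A := unif_closure _ _ _ => HA.
have AP f : polyfun f -> A f by exact: sub_unif_closure.
have [k' k'0 sl] := separated_slices c0 c1.
pose t v : R[i] := - 'i%C * quadric c (c / 2) 0 v.
have Ret y : Re (t y) = Im (quadric c (c / 2) 0 y).
  by rewrite /t; case: (quadric _ _ _ _) => p q /=; ring.
have nt y : normc (t y) = normc (quadric c (c / 2) 0 y).
  by rewrite Normc.normcM normcN {1}/normc /= expr0n expr1n add0r sqrtr1 mul1r.
pose C' := 2 + `|c / 2| + 4 * `|0 : R|.
have C'0 : 0 < C' by rewrite /C' normr0; have := normr_ge0 (c / 2); lra.
have tC m v : normc m = 1 -> plane c m v ->
    k' / C' * normc (t v) <= k' * normc (v 0 0) ^+ 2.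
  move=> hm /(quadric_bound (c / 2) 0 c0' c1' hm) h.
  by rewrite nt mulrAC ler_pdivrMr // -mulrA ler_pM2l // [leRHS]mulrC.
have kC' : 0 < k' / C' by exact: divr_gt0.
have t1 y : K1 y -> k' / C' * normc (t y) <= Re (t y).
  by move=> /K1p h; apply: le_trans (tC _ _ m1 h) _; rewrite Ret; exact: (sl y).1.
have t2 y : K2 y -> k' / C' * normc (t y) <= - Re (t y).
  by move=> /K2p h; apply: le_trans (tC _ _ m2 h) _; rewrite Ret; exact: (sl y).2.
have At : A t by apply: (hull_scale HA); apply: AP; exact: polyfun_quadric.
have tR y : (K1 `|` K2) y -> k' * normc (y 0 0) ^+ 2 <= normc (t y).
  have R1 := Re_le_normc (t y).
  case=> [/K1p/(sl y).1 h|/K2p/(sl y).2 h]; apply: le_trans h _; rewrite -Ret;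
    apply: le_trans R1; first exact: ler_norm.
  by rewrite -normrN; exact: ler_norm.
have [tx0|tx0] := eqVneq (t x) 0; last first.
  have [h|h] := kallin HA K10 K20 At kC' t1 t2 tx0; [constructor 2|constructor 3].
    apply: (@hull_plane K1 r) => //; first by move=> v i Kv; apply: Kr; left.
      exact: nz.
    by move=> f M Pf; exact: h (AP _ Pf).
  apply: (@hull_plane K2 r) => //; first by move=> v i Kv; apply: Kr; right.
    exact: nz.
  by move=> f M Pf; exact: h (AP _ Pf).
(* Again [x] is the origin. The values of [t] lie in a double sector around the real axis, so [i t]
   satisfies the slit condition of [hull_zero]. *)
constructor 1.
have Ait : A (fun y => 'i%C * t y) by exact: (hull_scale HA).
have k1 : 0 < k' / C' / (1 + k' / C') by rewrite divr_gt0 // addr_gt0.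
have sli y : (K1 `|` K2) y -> slit (k' / C' / (1 + k' / C')) ('i%C * t y).
  move=> Ky; apply: (cone_slit (ltW kC') _).1.
  case: Ky => [/t1|/t2] h; apply: le_trans h _; first exact: ler_norm.
  by rewrite -normrN; exact: ler_norm.
have it0 : 'i%C * t x = 0 by rewrite tx0 mulr0.
have nit y : normc ('i%C * t y) = normc (t y).
  by rewrite Normc.normcM {1}/normc /= expr0n expr1n add0r sqrtr1 mul1r.
have zge y : (K1 `|` K2) y -> normc (y 0 0) ^+ 2 <= k'^-1 * normc ('i%C * t y).
  by move=> Ky; rewrite nit ler_pdivlMl // tR.
have ki : 0 <= k'^-1 by rewrite invr_ge0 ltW.
apply: origin.
  exact: (hull_zero HA Ait (AP _ (polyfun_coord R 0)) k1 ki sli zge it0).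
apply: (hull_zero HA Ait (AP _ (polyfun_coord R 1)) k1 (_ : 0 <= 9 * k'^-1) sli _ it0).
  by rewrite mulr_ge0.
move=> y Ky; apply: le_trans (Wge y (or_intror Ky)) _.
by rewrite -mulrA ler_pM2l // zge.
Qed.

End HullOfPlanes.

(** * Closedness of the planes and polynomial convexity of the closed ball *)

Section Topology.
Variable R : realType.
Implicit Types (v x : Cvec R 2) (c e r : R) (m : R[i]).

Lemma nbhs_coord n (v : Cvec R n) e : 0 < e ->
  nbhs v [set u : Cvec R n | forall i, normc (v 0 i - u 0 i) < e].
Proof.
move=> e0; apply/nbhs_ballP; exists e%:C; first by rewrite /= ltcR.
move=> u /= [_ vu] i; have := vu 0 i; rewrite -ltcR.
by rewrite /ball /= /ball_ /= normc_def; case: (v 0 i - u 0 i).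
Qed.

Lemma coord_nbhs n (v : Cvec R n) (B : set (Cvec R n)) : nbhs v B ->
  exists2 e : R, 0 < e & forall u : Cvec R n,
    (forall i, normc (v 0 i - u 0 i) < e) -> B u.
Proof.
(* The radius of a ball is a complex number here; its positivity forces a zero imaginary part. *)
move=> /nbhs_ballP[[e e'] /= e0 eB]; have /andP[/eqP e'0 e0'] := e0.
exists e => // u vu; apply: eB; split => // i j; rewrite ord1.
have := vu j; rewrite -ltcR e'0 /ball /= /ball_ /= normc_def.
by case: (v 0 j - u 0 j).
Qed.

Lemma closure_approx n (A : set (Cvec R n)) (v : Cvec R n) e : closure A v -> 0 < e ->
  exists2 u, A u & forall i, normc (v 0 i - u 0 i) < e.
Proof. by move=> Av e0; have [u [Au vu]] := Av _ (nbhs_coord v e0); exists u. Qed.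

Lemma plane_closed c m : closed (plane c m).
Proof.
move=> v cv; rewrite /plane /=; apply/eqP; rewrite -subr_eq0; apply/eqP.
apply: Normc.eq0_normc; apply/eqP; rewrite eq_le normc_ge0 andbT.
apply/ler_addgt0Pr => e e0; rewrite add0r.
(* A Lipschitz constant, for the coordinatewise distance, of the difference of the two sides of the
   equation. *)
pose L := 1 + `|c| + normc m * (1 + `|c|).
have L0 : 0 < L.
  by rewrite ltr_wpDr ?ltr_wpDr // mulr_ge0 ?normc_ge0 // addr_ge0.
have [u pu vu] := closure_approx cv (divr_gt0 e0 L0).
have key (z w z' w' : R[i]) : w' + c%:C * z' = m * (z'^*%C + c%:C * z') ->
    normc (z - z') < e / L -> normc (w - w') < e / L ->
    normc (w + c%:C * z - m * (z^*%C + c%:C * z)) <= e.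
  move=> h hz hw.
  have -> : w + c%:C * z - m * (z^*%C + c%:C * z) =
      (w - w') + (c%:C * (z - z') - m * ((z - z')^*%C + c%:C * (z - z'))).
    rewrite rmorphB /=.
    have -> : w' = m * (z'^*%C + c%:C * z') - c%:C * z' by rewrite -h addrK.
    by ring.
  have cz : normc (c%:C * (z - z')) <= `|c| * (e / L).
    by rewrite Normc.normcM normc_real ler_wpM2l // ltW.
  apply: le_trans (le_normcD _ _) _; have -> : e = e / L + (e / L * `|c| + e / L * (normc m * (1 + `|c|))).
    by rewrite -{1}[e](divfK (lt0r_neq0 L0)) {2}/L; ring.
  apply: lerD; first exact: ltW.
  apply: le_trans (le_normcD _ _) _; rewrite normcN; apply: lerD; first by rewrite [leRHS]mulrC.
  rewrite Normc.normcM [leRHS]mulrCA ler_wpM2l ?normc_ge0 //.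
  apply: le_trans (le_normcD _ _) _; rewrite [leRHS]mulrDr mulr1 normc_conj; apply: lerD.
    exact: ltW.
  by rewrite [leRHS]mulrC.
exact: key pu (vu 0) (vu 1).
Qed.

Lemma enorm2 v : enorm v = Num.sqrt (normc (v 0 0) ^+ 2 + normc (v 0 1) ^+ 2).
Proof.
rewrite /enorm big_ord_recl big_ord1; congr (Num.sqrt (_ + normc (v 0 _) ^+ 2)).
exact: val_inj.
Qed.

Lemma enorm2_sqr v : enorm v ^+ 2 = normc (v 0 0) ^+ 2 + normc (v 0 1) ^+ 2.
Proof. by rewrite enorm2 sqr_sqrtr // addr_ge0 ?sqr_ge0. Qed.

Lemma enorm_ge0 n (v : Cvec R n) : 0 <= enorm v.
Proof. exact: sqrtr_ge0. Qed.

Lemma coord_le_enorm v i : normc (v 0 i) <= enorm v.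
Proof.
rewrite -(ler_pXn2r (n:=2)) ?nnegrE ?normc_ge0 ?enorm_ge0 // enorm2_sqr.
have [->|->] : i = 0 \/ i = 1.
  by case: i => [[|[|//]] hi]; [left|right]; exact: val_inj.
  by rewrite lerDl sqr_ge0.
by rewrite lerDr sqr_ge0.
Qed.

Lemma cauchy_schwarz2 x v :
  normc ((x 0 0)^*%C * v 0 0 + (x 0 1)^*%C * v 0 1) <= enorm x * enorm v.
Proof.
apply: le_trans (le_normcD _ _) _; rewrite !Normc.normcM !normc_conj.
rewrite -(ler_pXn2r (n:=2)) ?nnegrE ?addr_ge0 ?mulr_ge0 ?normc_ge0 ?enorm_ge0 //.
rewrite exprMn !enorm2_sqr -subr_ge0.
move: (normc (x 0 0)) (normc (x 0 1)) (normc (v 0 0)) (normc (v 0 1)) => a b p q.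
have -> : (a ^+ 2 + b ^+ 2) * (p ^+ 2 + q ^+ 2) - (a * p + b * q) ^+ 2 =
  (a * q - b * p) ^+ 2 by ring.
exact: sqr_ge0.
Qed.

Lemma closure_eball_dot x v : closure (eball (0 : Cvec R 2) 1) v ->
  normc ((x 0 0)^*%C * v 0 0 + (x 0 1)^*%C * v 0 1) <= enorm x.
Proof.
move=> cv; apply/ler_addgt0Pr => e e0.
pose L := normc (x 0 0) + normc (x 0 1) + 1.
have L0 : 0 < L by rewrite ltr_wpDl // addr_ge0 ?normc_ge0.
have [u] := closure_approx cv (divr_gt0 e0 L0).
rewrite /eball /= subr0 => u1 vu.
have := le_trans (cauchy_schwarz2 x u) (ler_wpM2l (enorm_ge0 x) (ltW u1)).
rewrite mulr1; have := vu 0; have := vu 1.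
move: (v 0 0 : R[i]) (v 0 1 : R[i]) (u 0 0 : R[i]) (u 0 1 : R[i]) => p q p' q' h1 h0 hu.
have -> : (x 0 0)^*%C * p + (x 0 1)^*%C * q = ((x 0 0)^*%C * p' + (x 0 1)^*%C * q') +
  ((x 0 0)^*%C * (p - p') + (x 0 1)^*%C * (q - q')) by ring.
apply: le_trans (le_normcD _ _) _; apply: lerD => //.
apply: le_trans (le_normcD _ _) _; rewrite !Normc.normcM !normc_conj.
apply: le_trans (_ : e / L * (normc (x 0 0) + normc (x 0 1)) <= _).
  rewrite mulrDr; apply: lerD; rewrite mulrC ler_wpM2r ?normc_ge0 //; exact: ltW.
have -> : normc (x 0 0) + normc (x 0 1) = L - 1 by rewrite /L addrK.
rewrite mulrBr divfK ?gt_eqF // mulr1 gerBl.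
by rewrite divr_ge0 // ltW.
Qed.

Lemma closure_eball_bounded : coord_bounded 2 (closure (eball (0 : Cvec R 2) 1)).
Proof.
move=> v i cv; have [u] := closure_approx cv ltr01.
rewrite /eball /= subr0 => u1 /(_ i) vu.
rewrite -(subrK (u 0 i) (v 0 i)); apply: le_trans (le_normcD _ _) _.
rewrite (_ : 2 = 1 + 1) //; apply: lerD; first exact: ltW.
exact: le_trans (coord_le_enorm u i) (ltW u1).
Qed.

Lemma enorm_closure_eball x : enorm x <= 1 -> closure (eball (0 : Cvec R 2) 1) x.
Proof.
move=> x1 B /coord_nbhs[e e0 eB].
pose d := Num.min 1 (e / 2).
have d0 : 0 < d by rewrite lt_min ltr01 divr_gt0.
have d1 : d <= 1 by rewrite ge_min lexx.
have de : d < e.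
  by apply: le_lt_trans (_ : e / 2 < e); [rewrite ge_min lexx orbT|lra].
pose u : Cvec R 2 := \row_i ((1 - d)%:C * x 0 i).
have nu i : normc (u 0 i) = (1 - d) * normc (x 0 i).
  by rewrite mxE Normc.normcM normc_real ger0_norm // subr_ge0.
exists u; split.
  rewrite /eball /= subr0.
  have -> : enorm u = (1 - d) * enorm x.
    apply/eqP; rewrite -(eqrXn2 (n:=2)) ?mulr_ge0 ?enorm_ge0 ?subr_ge0 //.
    by rewrite exprMn !enorm2_sqr !nu; apply/eqP; ring.
  have := enorm_ge0 x; nra.
apply: eB => i; rewrite mxE.
have -> : x 0 i - (1 - d)%:C * x 0 i = d%:C * x 0 i.
  by rewrite rmorphB rmorph1; ring.
rewrite Normc.normcM normc_real gtr0_norm //.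
have := le_trans (coord_le_enorm x i) x1; have := normc_ge0 (x 0 i); nra.
Qed.

(** The linear form [v |-> <v, x>] is bounded by [|x|] on the ball and takes the value [|x|^2] at
    [x], so [|x| <= 1]. *)
Lemma hull_closure_eball K x : K `<=` closure (eball (0 : Cvec R 2) 1) ->
  in_hull (@polyfun R 2) K x -> closure (eball (0 : Cvec R 2) 1) x.
Proof.
move=> Kb Kx; apply: enorm_closure_eball.
have Pf : polyfun (fun v : Cvec R 2 => (x 0 0)^*%C * v 0 0 + (x 0 1)^*%C * v 0 1).
  by apply: polyfun_add; apply: polyfun_mul;
    [exact: polyfun_const|exact: polyfun_coord|exact: polyfun_const|exact: polyfun_coord].
have := Kx _ (enorm x) Pf (fun v Kv => closure_eball_dot x (Kb v Kv)).
have -> : (x 0 0)^*%C * x 0 0 + (x 0 1)^*%C * x 0 1 = (enorm x ^+ 2)%:C.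
  rewrite enorm2_sqr !normc_sqr; case: (x 0 0) (x 0 1) => a b [p q].
  by apply/eqP; rewrite eq_complex /=; apply/andP; split; apply/eqP; ring.
rewrite normc_real ger0_norm ?sqr_ge0 //; have := enorm_ge0 x; nra.
Qed.

End Topology.

(** The hypothesis is [t^2 > (15 - sqrt 33) / 8], that is [t^-2 < (15 + sqrt 33) / 24], the larger
    root of [12 X^2 - 15 X + 4]. The smaller root lies below 3/4, where the first alternative
    holds. *)
Lemma threshold (R : realType) (t : R) :
  Num.sqrt (15 - Num.sqrt 33) / (2 * Num.sqrt 2) < t ->
  1 < t /\ (t^-1 ^+ 2 < 3 / 4 \/ 12 * t^-1 ^+ 4 - 15 * t^-1 ^+ 2 + 4 < 0).
Proof.
move=> ht; have q0 : 0 <= Num.sqrt 33 :> R by exact: sqrtr_ge0.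
have q2 : (Num.sqrt 33 : R) ^+ 2 = 33 by rewrite sqr_sqrtr.
move: (Num.sqrt 33 : R) q0 q2 ht => q q0 q2 ht.
(* This rational bound makes [(15 - q) / 8] exceed 1, whence [1 < t]. *)
have q5 : 0 <= q <= 29 / 5 by rewrite q0; nra.
have t0 : 0 < t.
  by apply: le_lt_trans ht; rewrite divr_ge0 ?mulr_ge0 ?sqrtr_ge0.
have tsq : (15 - q) / 8 < t ^+ 2.
  have -> : (15 - q) / 8 = (Num.sqrt (15 - q) / (2 * Num.sqrt 2)) ^+ 2.
    rewrite expr_div_n exprMn !sqr_sqrtr //; last lra.
    by congr (_ / _); ring.
  by rewrite ltr_pXn2r ?nnegrE ?divr_ge0 ?mulr_ge0 ?sqrtr_ge0 // ltW.
have t1 : 1 < t by nra.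
split=> //.
have c0 : 0 < t^-1 ^+ 2 by rewrite exprn_gt0 // invr_gt0.
have ct : t^-1 ^+ 2 * t ^+ 2 = 1 by rewrite -exprMn mulVf ?expr1n // gt_eqF.
have -> : t^-1 ^+ 4 = (t^-1 ^+ 2) ^+ 2 by rewrite -exprM.
move: (t^-1 ^+ 2) c0 ct => C C0 Ct.
have [h|h] := ltrP C (3 / 4); [by left|right].
have Cq : C * (15 - q) < 8 by nra.
have Cq2 : C < (15 + q) / 24 by nra.
nra.
Qed.

Theorem theorem1p6 (R : realType) (t : R)
    (ht : Num.sqrt (15 - Num.sqrt 33) / (2 * Num.sqrt 2) < t) :
  locally_poly_convex (@P0 R `|` P1 t `|` P2 t) 0.
Proof.
have [t1 hc] := threshold ht.
have t0 : 0 < t by exact: lt_trans t1.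
have tnz : t != 0 by rewrite gt_eqF.
have c0 : 0 < t^-1 by rewrite invr_gt0.
have c1 : t^-1 < 1 by rewrite invf_lt1.
rewrite (P0_plane t^-1) P1_plane // P2_plane //.
have zero m : plane t^-1 m (0 : Cvec R 2).
  by rewrite /plane /= !mxE !mulr0 addr0 rmorph0 addr0 mulr0.
split.
- by apply: closedU; [apply: closedU|]; exact: plane_closed.
- by left; left; exact: zero.
(* Real scalings preserve the planes, so any radius would serve. *)
exists 1 => //; rewrite /poly_convex !setIUl -setUA.
set B := closure _; apply/seteqP; split; last exact: poly_hull_sub.
move=> x /in_hull_poly Kx.
have B0 : B 0 by apply: enorm_closure_eball; rewrite enorm2 !mxE Normc.normc0 expr0n addr0 sqrtr0.
have Bx : B x.
  by apply: hull_closure_eball Kx => v [[_ //]|[[_ //]|[_ //]]].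
have [h|h|h] : [\/ plane t^-1 1 x, plane t^-1 (omega R) x | plane t^-1 (omegac R) x].
  apply: (hull_planes c0 c1 hc (r := 2) _ _ _ _ _ _ _ Kx).
  - by move=> v i [[_ Bv]|[[_ Bv]|[_ Bv]]]; exact: closure_eball_bounded.
  - exact: conj (zero _) B0.
  - exact: conj (zero _) B0.
  - exact: conj (zero _) B0.
  - exact: subIsetl.
  - exact: subIsetl.
  - exact: subIsetl.
- by left.
- by right; left.
- by right; right.
Qed.
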